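(* Let $\mathcal{C}:\mathcal{Q}Sym\to\mathcal{Y}Sym$, $\Gamma:\mathcal{Y}Sym\to\mathfrak{S}Sym$ and $\mathcal{Z}:\mathcal{Q}Sym\to\mathfrak{S}Sym$ be the linear maps $\mathcal{C}(M_{\mathsf{S}})=M_{C(\mathsf{S})}$, $\Gamma(M_t)=M_{\gamma(t)}$, $\mathcal{Z}(M_{\mathsf{S}})=M_{Z(\mathsf{S})}$. Then $\mathcal{C},\Gamma,\mathcal{Z}$ are injective morphisms of coalgebras, $\Gamma\circ\mathcal{C}=\mathcal{Z}$, and they split the surjections $\mathcal{L},\Lambda,\mathcal{D}$: $\mathcal{L}\circ\mathcal{C}=\mathrm{id}_{\mathcal{Q}Sym}$, $\Lambda\circ\Gamma=\mathrm{id}_{\mathcal{Y}Sym}$, $\mathcal{D}\circ\mathcal{Z}=\mathrm{id}_{\mathcal{Q}Sym}$.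
   Context: Permutations in one-line notation; $\mathrm{st}$ standardizes a sequence of distinct integers to a permutation with the same relative order. Weak order on $\mathfrak{S}_n$: inclusion of inversion sets. For $\sigma\in\mathfrak{S}_p,\tau\in\mathfrak{S}_q$: $\sigma\vee\tau=(\sigma(1)+q,..,\sigma(p)+q,p+q+1,\tau(1),..,\tau(q))$, $\sigma\backslash\tau=(\sigma(1)+q,..,\sigma(p)+q,\tau(1),..,\tau(q))$. $\mathrm{Des}(\sigma)=\{i:\sigma(i)>\sigma(i+1)\}$. For $\mathsf{S}=\{p_1<\dots<p_k\}\subseteq[n-1]$, $Z(\mathsf{S})=\mathrm{id}_{p_1}\backslash\mathrm{id}_{p_2-p_1}\backslash\cdots\backslash\mathrm{id}_{n-p_k}$. Trees: $\mathcal{Y}_n$ = rooted planar binary trees with $n$ internal nodes, $\mathcal{Y}_0=\{|\}$; $s\vee t$ = root with left subtree $s$, right subtree $t$. Tamari order generated by replacing a subtree $(a\vee b)\vee c$ by the larger $a\vee(b\vee c)$. $s\backslash t$: $|\backslash t=t$, $s\backslash t=s_l\vee(s_r\backslash t)$. $1_0=|$, $1_n=1_{n-1}\vee|$, $C(\mathsf{S})=1_{p_1}\backslash\cdots\backslash1_{n-p_k}$. $L(t)$: with leaves numbered $0..n$, the set of $i\in[n-1]$ with leaf $i$ a left child. $\lambda(\mathrm{id}_0)=|$, $\lambda(\sigma)=\lambda(\mathrm{st}(\sigma(1..j-1)))\vee\lambda(\mathrm{st}(\sigma(j+1..n)))$, $j=\sigma^{-1}(n)$; $\gamma(|)=\mathrm{id}_0$,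 $\gamma(t)=\gamma(t_l)\vee\gamma(t_r)$. Hopf algebras over $\mathbb{Q}$: $\mathfrak{S}Sym$ has basis $F_\sigma$ with coproduct $\Delta(F_\sigma)=\sum_{p=0}^nF_{\mathrm{st}(\sigma(1),..,\sigma(p))}\otimes F_{\mathrm{st}(\sigma(p+1),..,\sigma(n))}$ and $M_\sigma=\sum_{\sigma\le\tau}\mu_{\mathfrak{S}_n}(\sigma,\tau)F_\tau$. $\mathcal{Y}Sym$ has basis $F_t$ with coproduct $\Delta(F_t)=\sum_iF_{t_0}\otimes F_{t_1}$ over splittings $t\to(t_0,t_1)$ at leaves $i=0..n$, defined recursively by $|\to(|,|)$ and, for $t=t_l\vee t_r$, $t\to(a,b\vee t_r)$ if the leaf is in $t_l$ and $t_l\to(a,b)$, $t\to(t_l\vee c,d)$ if the leaf is in $t_r$ and $t_r\to(c,d)$; and $M_t=\sum_{t\le s}\mu_{\mathcal{Y}_n}(t,s)F_s$. $\mathcal{Q}Sym$ has in degree $n$ bases $M_{\mathsf{S}},F_{\mathsf{S}}$, $\mathsf{S}\subseteq[n-1]$, with $F_{\mathsf{S}}=\sum_{\mathsf{T}\supseteq\mathsf{S}}M_{\mathsf{T}}$; identifying $\mathsf{S}=\{p_1<\dots<p_k\}$ with the composition $(a_1,\dots,a_{k+1})=(p_1,p_2-p_1,\dots,n-p_k)$, the coproduct is $\Delta(M_{(a_1,\dots,a_m)})=\sum_{i=0}^mM_{(a_1,\dots,a_i)}\otimes M_{(a_{i+1},\dots,a_m)}$. The Hopf morphisms $\Lambda:\mathfrak{S}Sym\to\mathcal{Y}Sym$,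 $\mathcal{L}:\mathcal{Y}Sym\to\mathcal{Q}Sym$, $\mathcal{D}:\mathfrak{S}Sym\to\mathcal{Q}Sym$ are $F_\sigma\mapsto F_{\lambda(\sigma)}$, $F_t\mapsto F_{L(t)}$, $F_\sigma\mapsto F_{\mathrm{Des}(\sigma)}$. *)

(* Defs.v *)
From HB Require Import structures.
From mathcomp Require Import all_boot all_order all_algebra.
From mathcomp Require Import freeg.

Set Implicit Arguments.
Unset Strict Implicit.
Unset Printing Implicit Defensive.

Import Order.TTheory GRing.Theory Num.Theory.
Local Open Scope ring_scope.

(* Möbius function of a finite poset (T, le): the inverse of the zeta
   function in the incidence algebra, i.e. the inverse of the zeta matrix
   Z(x,y) = [x <= y]. *)
Definition mobius (T : finType) (le : rel T) (x y : T) : rat :=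
  let Z : 'M[rat]_#|T| := \matrix_(i, j) (le (enum_val i) (enum_val j))%:R in
  invmx Z (enum_rank x) (enum_rank y).

(* Tensor product of free vector spaces: basis = pairs of basis elements. *)
Definition tens (K1 K2 : choiceType) (u : {freeg K1 / rat}) (v : {freeg K2 / rat})
  : {freeg (K1 * K2)%type / rat} :=
  fglift (fun x : K1 => fglift (fun y : K2 => << (x, y) >> : {freeg (K1 * K2)%type / rat}) v) u.

Definition tmap (K1 K2 K3 K4 : choiceType)
  (f : {freeg K1 / rat} -> {freeg K3 / rat}) (g : {freeg K2 / rat} -> {freeg K4 / rat})
  (w : {freeg (K1 * K2)%type / rat}) : {freeg (K3 * K4)%type / rat} :=
  fglift (fun p : K1 * K2 => tens (f << p.1 >>) (g << p.2 >>)) w.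

(* all subsequences of a list (subsets when the list is sorted) *)
Fixpoint subseqs (s : seq nat) : seq (seq nat) :=
  match s with
  | [::] => [:: [::]]
  | x :: s' => [seq x :: t | t <- subseqs s'] ++ subseqs s'
  end.

Definition is_perm (s : seq nat) : bool := perm_eq s (iota 1 (size s)).
Definition perm_key := {s : seq nat | is_perm s}.
Definition perm0 : perm_key := exist _ [::] (erefl true).
Definition mkperm (s : seq nat) : perm_key := insubd perm0 s.

Definition st (s : seq nat) : seq nat := [seq (count (fun y => y < x)%N s).+1 | x <- s].

Definition pvee (s t : seq nat) : seq nat :=
  [seq (x + size t)%N | x <- s] ++ (size s + size t).+1 :: t.
Definition pbsl (s t : seq nat) : seq nat := [seq (x + size t)%N | x <- s] ++ t.
Definition idp (n : nat) : seq nat := iota 1 n.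

Definition inversions (s : seq nat) : seq (nat * nat) :=
  [seq ij <- [seq (i, j) | i <- iota 0 (size s), j <- iota 0 (size s)]
     | (ij.1 < ij.2)%N && (nth 0 s ij.2 < nth 0 s ij.1)%N].
Definition weak_le (s t : seq nat) : bool := all (fun ij => ij \in inversions t) (inversions s).

Definition Des (s : seq nat) : seq nat :=
  [seq i <- iota 1 (size s).-1 | (nth 0 s i < nth 0 s i.-1)%N].

Definition permsn (n : nat) : seq (seq nat) := permutations (idp n).
Lemma idp_in_permsn n : idp n \in permsn n.
Proof. by rewrite mem_permutations perm_refl. Qed.
Definition PermN (n : nat) : finType := seq_sub (permsn n).
Definition to_permn (n : nat) (s : seq nat) : PermN n :=
  insubd (SeqSub (idp_in_permsn n) : PermN n) s.
Definition weak_leN (n : nat) : rel (PermN n) := fun a b => weak_le (val a) (val b).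

Inductive tree := Leaf | Node of tree & tree.

Fixpoint tree_enc (t : tree) : GenTree.tree nat :=
  match t with
  | Leaf => GenTree.Node 0 [::]
  | Node l r => GenTree.Node 1 [:: tree_enc l; tree_enc r]
  end.
Fixpoint tree_dec (g : GenTree.tree nat) : option tree :=
  match g with
  | GenTree.Node 0 [::] => Some Leaf
  | GenTree.Node 1 [:: a; b] =>
      match tree_dec a, tree_dec b with
      | Some l, Some r => Some (Node l r)
      | _, _ => None
      end
  | _ => None
  end.
Lemma tree_encK : pcancel tree_enc tree_dec.
Proof. by elim=> [|l IHl r IHr] //=; rewrite IHl IHr. Qed.
HB.instance Definition _ := Countable.copy tree (pcan_type tree_encK).

Fixpoint tsize (t : tree) : nat :=
  match t with Leaf => 0%N | Node l r => (tsize l + tsize r).+1 end.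

Fixpoint tbsl (s t : tree) : tree :=
  match s with Leaf => t | Node sl sr => Node sl (tbsl sr t) end.

Fixpoint lcomb (n : nat) : tree :=
  match n with 0 => Leaf | n'.+1 => Node (lcomb n') Leaf end.

(* lambda : permutations -> trees; fuel = size s suffices since the two
   recursive arguments have size < size s *)
Fixpoint lam_rec (k : nat) (s : seq nat) : tree :=
  match k with
  | 0 => Leaf
  | k'.+1 =>
      if s is [::] then Leaf else
      let j := index (\max_(x <- s) x)%N s in
      Node (lam_rec k' (st (take j s))) (lam_rec k' (st (drop j.+1 s)))
  end.
Definition lambda (s : seq nat) : tree := lam_rec (size s) s.

Fixpoint gamma (t : tree) : seq nat :=
  match t with Leaf => [::] | Node l r => pvee (gamma l) (gamma r) end.

Fixpoint leaf_flags (t : tree) (isleft : bool) : seq bool :=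
  match t with Leaf => [:: isleft] | Node l r => leaf_flags l true ++ leaf_flags r false end.
Definition Lset (t : tree) : seq nat :=
  [seq i <- iota 1 (tsize t).-1 | nth false (leaf_flags t false) i].

(* splittings t -> (t0, t1) at the leaves 0..n *)
Fixpoint splits (t : tree) : seq (tree * tree) :=
  match t with
  | Leaf => [:: (Leaf, Leaf)]
  | Node l r => [seq (ab.1, Node ab.2 r) | ab <- splits l]
                ++ [seq (Node l cd.1, cd.2) | cd <- splits r]
  end.

Fixpoint rots (t : tree) : seq tree :=
  match t with
  | Leaf => [::]
  | Node l r =>
      (if l is Node a b then [:: Node a (Node b r)] else [::])
      ++ [seq Node l' r | l' <- rots l] ++ [seq Node l r' | r' <- rots r]
  end.

Fixpoint trees_h (k : nat) : seq tree :=
  match k with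
  | 0 => [:: Leaf]
  | k'.+1 => Leaf :: [seq Node lr.1 lr.2 | lr <- [seq (l, r) | l <- trees_h k', r <- trees_h k']]
  end.
Definition treesn (n : nat) : seq tree := [seq t <- trees_h n | tsize t == n].
Lemma leaf_in_trees_h k : Leaf \in trees_h k.
Proof. by case: k => //= k; rewrite in_cons eqxx. Qed.
Lemma lcomb_in_treesn n : lcomb n \in treesn n.
Proof.
have h : tsize (lcomb n) = n by elim: n => //= n ->; rewrite addn0.
rewrite mem_filter h eqxx /=.
elim: n {h} => [|n IH] //=; rewrite in_cons; apply/orP; right.
apply/mapP; exists (lcomb n, Leaf) => //; apply/allpairsP; exists (lcomb n, Leaf).
by split => //; apply: leaf_in_trees_h.
Qed.
Definition TreeN (n : nat) : finType := seq_sub (treesn n).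
Definition to_treen (n : nat) (t : tree) : TreeN n :=
  insubd (SeqSub (lcomb_in_treesn n) : TreeN n) t.
Definition tam_leN (n : nat) : rel (TreeN n) :=
  connect (fun a b : TreeN n => val b \in rots (val a)).

Definition is_comp (c : seq nat) : bool := all (fun a => 0 < a)%N c.
Definition comp_key := {c : seq nat | is_comp c}.
Definition comp0 : comp_key := exist _ [::] (erefl true).
Definition mkcomp (c : seq nat) : comp_key := insubd comp0 c.

(* S = {p1 < ... < pk} subset of [n-1]  |->  (p1, p2-p1, ..., n-pk) *)
Definition comp_of_set (n : nat) (S : seq nat) : seq nat :=
  if n == 0%N then [::] else pairmap (fun a b => b - a)%N 0%N (rcons S n).

Definition Cmap (c : seq nat) : tree := foldr tbsl Leaf (map lcomb c).
Definition Zmap (c : seq nat) : seq nat := foldr pbsl [::] (map idp c).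

(* SSym, coordinates in the F basis *)
Definition SSym := {freeg perm_key / rat}.
Definition FS (s : seq nat) : SSym := << mkperm s >>.
Definition MS (s : seq nat) : SSym :=
  let n := size s in
  \sum_(u : PermN n | weak_leN (to_permn n s) u)
     mobius (@weak_leN n) (to_permn n s) u *: FS (val u).
Definition DeltaS (v : SSym) : {freeg (perm_key * perm_key)%type / rat} :=
  fglift (fun x : perm_key =>
    \sum_(p < (size (val x)).+1)
      << (mkperm (st (take p (val x))), mkperm (st (drop p (val x)))) >>
      : {freeg (perm_key * perm_key)%type / rat}) v.
Definition epsS (v : SSym) : rat^o :=
  fglift (fun x : perm_key => ((size (val x) == 0%N)%:R : rat^o)) v.

(* YSym, coordinates in the F basis *)
Definition YSym := {freeg tree / rat}.
Definition FY (t : tree) : YSym := << t >>.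
Definition MY (t : tree) : YSym :=
  let n := tsize t in
  \sum_(s : TreeN n | tam_leN (to_treen n t) s)
     mobius (@tam_leN n) (to_treen n t) s *: FY (val s).
Definition DeltaY (v : YSym) : {freeg (tree * tree)%type / rat} :=
  fglift (fun t : tree =>
    \sum_(ab <- splits t) << ab >> : {freeg (tree * tree)%type / rat}) v.
Definition epsY (v : YSym) : rat^o :=
  fglift (fun t : tree => ((t == Leaf)%:R : rat^o)) v.

(* QSym, coordinates in the M basis (indexed by compositions) *)
Definition QSym := {freeg comp_key / rat}.
Definition MQ (c : seq nat) : QSym := << mkcomp c >>.
Definition FQ (n : nat) (S : seq nat) : QSym :=
  \sum_(T <- subseqs (iota 1 n.-1) | all (fun i => i \in T) S) MQ (comp_of_set n T).
Definition DeltaQ (v : QSym) : {freeg (comp_key * comp_key)%type / rat} :=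
  fglift (fun c : comp_key =>
    \sum_(i < (size (val c)).+1)
      << (mkcomp (take i (val c)), mkcomp (drop i (val c))) >>
      : {freeg (comp_key * comp_key)%type / rat}) v.
Definition epsQ (v : QSym) : rat^o :=
  fglift (fun c : comp_key => ((val c == [::])%:R : rat^o)) v.

Definition LambdaM (v : SSym) : YSym := fglift (fun x : perm_key => FY (lambda (val x))) v.
Definition LM (v : YSym) : QSym := fglift (fun t : tree => FQ (tsize t) (Lset t)) v.
Definition DM (v : SSym) : QSym := fglift (fun x : perm_key => FQ (size (val x)) (Des (val x))) v.

(* C and Z, defined on the M basis of QSym (= its coordinate basis) *)
Definition CM (v : QSym) : YSym := fglift (fun c : comp_key => MY (Cmap (val c))) v.
Definition ZM (v : QSym) : SSym := fglift (fun c : comp_key => MS (Zmap (val c))) v.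

(* Main.v *)
From HB Require Import structures.
From mathcomp Require Import all_boot all_order all_algebra.
From mathcomp Require Import freeg zify.
Require Import Defs.
Import GRing.Theory.

Set Implicit Arguments.
Unset Strict Implicit.
Unset Printing Implicit Defensive.

(** Encode a tree by its bracketing vector, the in-order list of the sizes of the
    left subtrees of its nodes. The Tamari order is then the reversed componentwise
    order, [i < j] is a non-inversion of [gamma t] iff [i] lies in the left subtree
    of [j], and [i] belongs to [Lset t] iff its entry vanishes. Reading off the
    vector of [lambda s] gives the Galois connections
    [lambda s <= t <-> s <= gamma t] and [Lset t] included in [S] [<-> t <= C(S)],
    as well as [x <= a \ b <-> x_0 <= a /\ x_1 <= b] for the splitting [(x_0, x_1)]
    of [x] into parts of the sizes of [a] and [b], for trees and for permutations.

    By Moebius inversion, a linear map [f] with [f (F_x) = sum_{y >= x} k y] for all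
    [x] satisfies [f (M_x) = k x]. Applied to [Lambda], [L] and the coproducts, the
    connections above give [Lambda (M_{gamma t}) = M_t], [L (M_{C(S)}) = M_S] and
    [Delta (M_x) = sum_{a \ b = x} M_a (x) M_b]. The decompositions [a \ b] of
    [gamma t] are the images of those of [t], and those of [C(S)] come from cutting
    the composition; the statements on [Z] and [D] follow from
    [Z = Gamma C] and [D = L Lambda]. *)

Local Open Scope nat_scope.

(** * Bracketing vectors and the Tamari order *)

Fixpoint bvec (t : tree) : seq nat :=
  if t is Node l r then bvec l ++ tsize l :: bvec r else [::].

Lemma size_bvec t : size (bvec t) = tsize t.
Proof. by elim: t => //= l IHl r IHr; rewrite size_cat /= IHl IHr addnS. Qed.

Lemma nth_bvec_node l r j : nth 0 (bvec (Node l r)) j =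
  if j < tsize l then nth 0 (bvec l) j
  else if j == tsize l then tsize l else nth 0 (bvec r) (j - (tsize l).+1).
Proof.
rewrite /= nth_cat size_bvec; case: ltnP => // le_lj; case: eqP => [->|/eqP ne_jl].
  by rewrite subnn.
by rewrite (_ : j - tsize l = (j - (tsize l).+1).+1) //; lia.
Qed.

(** Nodes are numbered from [0] in in-order, so only [j] nodes precede node [j]. *)
Lemma nth_bvec_le t j : nth 0 (bvec t) j <= j.
Proof.
elim: t j => [|l IHl r IHr] j; first by rewrite nth_nil.
rewrite nth_bvec_node; case: ltnP => // le_lj; case: eqP => [->//|_].
by apply: leq_trans (IHr _) _; rewrite leq_subr.
Qed.

Lemma nth_bvec_default t j : tsize t <= j -> nth 0 (bvec t) j = 0.
Proof. by move=> h; rewrite nth_default ?size_bvec. Qed.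

(** The root is the last position whose entry equals its index: an entry of the right subtree at
    position [j] is at most [j - (tsize l).+1]. The vector therefore determines where to cut it. *)
Lemma bvec_inj : injective bvec.
Proof.
elim=> [|l IHl r IHr] [|l' r'] //; try by move/(congr1 size); rewrite !size_bvec.
have key (a b c d : tree) : bvec (Node a b) = bvec (Node c d) -> tsize c <= tsize a.
  move=> e; rewrite leqNgt; apply/negP => lt_ac.
  have := congr1 (fun v => nth 0 v (tsize c)) e.
  rewrite !nth_bvec_node ltnn eqxx.
  have := nth_bvec_le b (tsize c - (tsize a).+1).
  by case: ltngtP; lia.
move=> e; have e1 : tsize l = tsize l'.
  by apply/eqP; rewrite eqn_leq (key _ _ _ _ e) (key _ _ _ _ (esym e)).
move: e => /= /eqP; rewrite eqseq_cat ?size_bvec // => /andP[/eqP /IHl ->].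
by case/eqP=> /IHr ->.
Qed.

(** If the left subtree of node [j.+1] is nonempty, its last node is [j], and the left subtree of
    [j] lies strictly inside it. *)
Lemma nth_bvec_succ t j : 0 < nth 0 (bvec t) j.+1 ->
  nth 0 (bvec t) j < nth 0 (bvec t) j.+1.
Proof.
elim: t j => [|l IHl r IHr] j; first by rewrite nth_nil.
rewrite !nth_bvec_node; case: (ltnP j.+1 (tsize l)) => [lt_jl|le_lj].
  by rewrite (ltnW lt_jl); apply: IHl.
case: eqP => [<-|/eqP ne_jl]; first by move=> _; rewrite leqnn ltnS nth_bvec_le.
have [-> ->] : (j < tsize l) = false /\ (j.+1 - (tsize l).+1 = j - tsize l) by lia.
case: eqP => [->|/eqP ne_jl']; first by have := nth_bvec_le r (tsize l - tsize l); lia.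
rewrite (_ : j - tsize l = (j - (tsize l).+1).+1); last lia.
exact: IHr.
Qed.

(** Beyond the nodes of [t] the default entry [0] makes the condition vacuous, so a finite check
    suffices. *)
Definition tam_le (s t : tree) : bool :=
  all (fun j => nth 0 (bvec t) j <= nth 0 (bvec s) j) (iota 0 (tsize t)).

Lemma tam_leP s t :
  reflect (forall j, nth 0 (bvec t) j <= nth 0 (bvec s) j) (tam_le s t).
Proof.
apply: (iffP allP) => h j //.
by have [lt_jt|le_tj] := ltnP j (tsize t); [apply: h; rewrite mem_iota|
  rewrite nth_bvec_default].
Qed.

Lemma tam_le_refl : reflexive tam_le.
Proof. by move=> t; apply/tam_leP. Qed.

Lemma tam_le_trans : transitive tam_le.
Proof.
move=> t s u /tam_leP h1 /tam_leP h2; apply/tam_leP => j.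
exact: leq_trans (h2 j) (h1 j).
Qed.

Lemma tam_le_anti s t : tsize s = tsize t -> tam_le s t -> tam_le t s -> s = t.
Proof.
move=> e /tam_leP h1 /tam_leP h2; apply: bvec_inj.
apply: (@eq_from_nth _ 0) => [|j _]; first by rewrite !size_bvec.
by apply/eqP; rewrite eqn_leq h1 h2.
Qed.

Lemma rots_tsize s t : t \in rots s -> tsize t = tsize s.
Proof.
elim: s t => [|l IHl r IHr] t //=; rewrite !mem_cat => /or3P[]; last 2 first.
- by case/mapP=> l' /IHl e -> /=; rewrite e.
- by case/mapP=> r' /IHr e -> /=; rewrite e.
by case: l {IHl} => //= a b; rewrite inE => /eqP -> /=; lia.
Qed.

(** A rotation preserves the in-order numbering and changes one entry only: that of the upper node
    of [(a v b) v c], which drops from [tsize a + tsize b + 1] to [tsize b]. *)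
Lemma rots_tam_le s t : t \in rots s -> tam_le s t.
Proof.
move=> h; apply/tam_leP; elim: s t h => [|l IHl r IHr] t // h j; move: h.
rewrite nth_bvec_node [rots _]/= !mem_cat => /or3P[]; last 2 first.
- case/mapP=> l' hl ->; rewrite nth_bvec_node (rots_tsize hl).
  by case: ltnP => // _; apply: IHl.
- case/mapP=> r' hr ->; rewrite nth_bvec_node.
  by case: ltnP => // _; case: eqP => // _; apply: IHr.
case: l {IHl} => // a b; rewrite mem_seq1 => /eqP ->; rewrite !nth_bvec_node.
rewrite (_ : tsize (Node a b) = (tsize a + tsize b).+1) //.
case: (ltnP j (tsize a)) => h1; first by rewrite (_ : j < _); last lia.
case: eqP => [->|/eqP h2]; first by rewrite (_ : _ < _); last lia.
case: (ltnP (j - _) _) => h3; first by rewrite (_ : j < _); last lia.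
rewrite (_ : j < _ = false); last lia.
case: eqP => h4; first by rewrite (_ : j == _); lia.
rewrite (_ : j == _ = false); last lia.
by rewrite (_ : j - (tsize a).+1 - (tsize b).+1 = j - (tsize a + tsize b).+2); last lia.
Qed.

(** Reachability on bare trees can be transported into subtrees of any size, whereas the [connect]
    in [tam_leN] lives in one fixed size. *)
Inductive rotstar : tree -> tree -> Prop :=
| rotstar_refl t : rotstar t t
| rotstar_step s t u : t \in rots s -> rotstar t u -> rotstar s u.

Lemma rotstar_trans s t u : rotstar s t -> rotstar t u -> rotstar s u.
Proof.
by move=> h; elim: h u => // a b c hab _ IH u /IH; apply: rotstar_step.
Qed.

Lemma rotstar_node l l' r r' :
  rotstar l l' -> rotstar r r' -> rotstar (Node l r) (Node l' r').
Proof.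
move=> hl hr; apply: (@rotstar_trans _ (Node l' r)).
  elim: hl => [*|a b c hab _ IH]; first exact: rotstar_refl.
  apply: rotstar_step IH => /=; rewrite !mem_cat (map_f (fun x => Node x r)) //.
  by rewrite orbT.
elim: hr => [*|a b c hab _ IH]; first exact: rotstar_refl.
by apply: rotstar_step IH => /=; rewrite !mem_cat (map_f (Node l')) // !orbT.
Qed.

(** Splitting at leaf [p]: the left subtree holds the leaves [0 .. tsize l], and the first [p] nodes
    go to the left part. *)
Fixpoint tsplit (p : nat) (t : tree) : tree * tree :=
  if t is Node l r then
    if p <= tsize l then ((tsplit p l).1, Node (tsplit p l).2 r)
    else (Node l (tsplit (p - (tsize l).+1) r).1, (tsplit (p - (tsize l).+1) r).2)
  else (Leaf, Leaf).

Lemma tsize_tsplit1 p t : p <= tsize t -> tsize (tsplit p t).1 = p.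
Proof.
elim: t p => [|l IHl r IHr] p /=; first by case: p.
by case: (leqP p (tsize l)) => [le_pl|lt_lp] le_pt /=; rewrite ?IHl ?IHr; lia.
Qed.

Lemma tsize_tsplit2 p t : p <= tsize t -> tsize (tsplit p t).2 = tsize t - p.
Proof.
elim: t p => [|l IHl r IHr] p //=.
by case: (leqP p (tsize l)) => [le_pl|lt_lp] le_pt /=; rewrite ?IHl ?IHr; lia.
Qed.

Lemma splitsE t : splits t = [seq tsplit p t | p <- iota 0 (tsize t).+1].
Proof.
elim: t => // l IHl r IHr; rewrite [splits _]/= IHl IHr -!map_comp.
rewrite (_ : (tsize (Node l r)).+1 = (tsize l).+1 + (tsize r).+1); last by rewrite /=; lia.
rewrite iotaD map_cat; congr (_ ++ _).
  by apply/eq_in_map => p; rewrite mem_iota /= => h; rewrite (_ : p <= tsize l); last lia.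
rewrite -[0 + _]addn0 add0n iotaDl -map_comp; apply/eq_in_map => p _ /=.
rewrite (_ : _ <= _ = false); last lia.
by rewrite (_ : _ - _ = p); last lia.
Qed.

Lemma nth_bvec_tsplit1 p t j : p <= tsize t ->
  nth 0 (bvec (tsplit p t).1) j = if j < p then nth 0 (bvec t) j else 0.
Proof.
elim: t p j => [|l IHl r IHr] p j /=; first by rewrite nth_nil if_same.
rewrite -!/(bvec (Node _ _)) nth_bvec_node.
case: (leqP p (tsize l)) => lp le_pt.
  rewrite /= IHl //; case: ltnP => // lt_jp.
  by rewrite (leq_trans lt_jp lp).
rewrite -!/(bvec (Node _ _)) nth_bvec_node; case: ltnP => h1.
  by rewrite (_ : j < p); last lia.
case: eqP => h2; first by rewrite (_ : j < p); last lia.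
by rewrite IHr; last lia; congr (if _ then _ else _); lia.
Qed.

(** The left subtree of node [p + j] is an interval ending just before it; removing the nodes before
    [p] leaves at most [j] of them, hence the minimum. *)
Lemma nth_bvec_tsplit2 p t j : p <= tsize t ->
  nth 0 (bvec (tsplit p t).2) j = minn (nth 0 (bvec t) (p + j)) j.
Proof.
elim: t p j => [|l IHl r IHr] p j /=; first by rewrite !nth_nil min0n.
rewrite -!/(bvec (Node _ _)) nth_bvec_node.
case: (leqP p (tsize l)) => lp le_pt /=.
  rewrite -!/(bvec (Node _ _)) nth_bvec_node tsize_tsplit2 // IHl //.
  case: ltnP => h1; first by rewrite (_ : _ < _); last lia.
  rewrite (_ : _ < _ = false); last lia.
  case: eqP => h2; first by rewrite (_ : _ == _); lia.
  rewrite (_ : _ == _ = false); last lia.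
  rewrite (_ : j - (tsize l - p).+1 = p + j - (tsize l).+1); last lia.
  by have := nth_bvec_le r (p + j - (tsize l).+1); lia.
rewrite IHr; last lia.
rewrite (_ : _ < _ = false); last lia.
rewrite (_ : _ == _ = false); last lia.
by congr (minn (nth _ _ _) _); lia.
Qed.

(* With [k <= m] the sizes of the left subtrees of [s] and [t], the case [k < m]
   goes through [t -> (sl v c) v tr -> sl v (c v tr) -> s], where [c] is the tree
   of the first [m - k - 1] nodes of [sr]. *)
Lemma tam_le_rotstar t s : tsize t = tsize s -> tam_le t s -> rotstar t s.
Proof.
(* The induction is on the number of nodes, since [Node c tr] below is not a subtree of [t]. *)
elim: {t}(tsize t).+1 {-2}t (ltnSn (tsize t)) s => // n IHn.
case=> [|tl tr] le_tn [|sl sr] //= => [_ _|e]; first exact: rotstar_refl.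
move/tam_leP => h; move: le_tn => /= le_tn.
have e' : tsize tl + tsize tr = tsize sl + tsize sr by lia.
have le_k : tsize sl <= tsize tl.
  have := h (tsize sl); rewrite -!/(bvec (Node _ _)) !nth_bvec_node ltnn eqxx.
  by have := nth_bvec_le tr (tsize sl - (tsize tl).+1); case: ltngtP; lia.
have [eq_k|lt_k] : tsize sl = tsize tl \/ tsize sl < tsize tl by lia.
  apply: rotstar_node; apply: IHn; try lia; apply/tam_leP => j.
    have [lt_j|le_j] := ltnP j (tsize sl); last by rewrite nth_bvec_default.
    by have := h j; rewrite -!/(bvec (Node _ _)) !nth_bvec_node -eq_k lt_j.
  have := h ((tsize sl).+1 + j); rewrite -!/(bvec (Node _ _)) !nth_bvec_node -eq_k.
  rewrite (_ : _ < _ = false); last lia.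
  rewrite (_ : _ == _ = false); last lia.
  by rewrite addKn.
pose p := tsize tl - (tsize sl).+1; pose c := (tsplit p sr).1.
have le_p : p <= tsize sr by rewrite /p; lia.
have sz_c : tsize c = p by rewrite tsize_tsplit1.
have h1 : rotstar tl (Node sl c).
  apply: IHn; rewrite /= ?sz_c /p; try lia; apply/tam_leP => j.
  have [lt_j|le_j] := ltnP j (tsize tl); last first.
    by rewrite nth_bvec_default //= sz_c /p; lia.
  have := h j; rewrite -!/(bvec (Node _ _)) !nth_bvec_node lt_j.
  case: ltnP => // le_j; case: eqP => // ne_j; rewrite nth_bvec_tsplit1 //.
  by case: ltnP.
apply: rotstar_trans (rotstar_node h1 (rotstar_refl tr)) _.
apply: (@rotstar_step _ (Node sl (Node c tr))); first by rewrite /= inE eqxx.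
apply: rotstar_node; first exact: rotstar_refl.
apply: IHn; rewrite /= ?sz_c /p; try lia; apply/tam_leP => j.
rewrite -!/(bvec (Node _ _)) nth_bvec_node nth_bvec_tsplit1 // sz_c.
case: ltnP => // le_j; case: eqP => [->|ne_j]; first exact: nth_bvec_le.
have := h ((tsize sl).+1 + j); rewrite -!/(bvec (Node _ _)) !nth_bvec_node.
rewrite (_ : _ < _ = false); last lia.
rewrite (_ : _ == _ = false); last lia.
rewrite (_ : _ < _ = false); last by move: le_j; rewrite /p; lia.
rewrite (_ : _ == _ = false); last by move: le_j ne_j; rewrite /p; lia.
rewrite addKn => /leq_trans; apply; rewrite (_ : _ - _ = j - p.+1) //.
by rewrite /p; lia.
Qed.

Lemma treesn_mem n t : (t \in treesn n) = (tsize t == n).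
Proof.
rewrite mem_filter andb_idr // => /eqP <-{n}.
have key k : tsize t <= k -> t \in trees_h k.
  elim: t k => [|l IHl r IHr] k; first by rewrite leaf_in_trees_h.
  case: k => //= k le_k; rewrite inE; apply/orP; right.
  apply/mapP; exists (l, r) => //; apply/allpairsP; exists (l, r).
  by split; rewrite ?IHl ?IHr //=; lia.
exact: key.
Qed.

Lemma treesn_uniq n : uniq (treesn n).
Proof.
apply: filter_uniq; elim: n => //= n IHn; rewrite map_inj_uniq; last first.
  by move=> [a b] [c d] [-> ->].
apply/andP; split; first by apply/mapP => -[].
by apply: allpairs_uniq => // -[a b] [c d] _ _ [-> ->].
Qed.

Lemma tam_leNE n (a b : TreeN n) : tam_leN a b = tam_le (val a) (val b).
Proof.
have sz (x : TreeN n) : tsize (val x) = n.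
  by apply/eqP; rewrite -treesn_mem; apply: (valP x).
apply/idP/idP.
  case/connectP=> p; elim: p a => [|c p IHp] a /= => [_ ->|/andP[h1 h2] e].
    exact: tam_le_refl.
  exact: tam_le_trans (rots_tam_le h1) (IHp _ h2 e).
(* Rotations preserve the number of nodes, so a chain of rotations starting in [TreeN n] stays
   there. *)
have key s t : rotstar s t -> forall x : TreeN n, val x = s ->
    exists2 y : TreeN n, val y = t & tam_leN x y.
  elim=> [u x ex|u v w huv _ IH x ex]; first by exists x => //; apply: connect0.
  have hv : v \in treesn n by rewrite treesn_mem (rots_tsize huv) -ex sz.
  have [y ey hy] := IH (SeqSub hv) erefl; exists y => //.
  by apply: connect_trans hy; apply: connect1; rewrite ex.
move/(tam_le_rotstar (etrans (sz a) (esym (sz b)))) => /key -/(_ a erefl).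
by case=> y /val_inj ->.
Qed.

(** * Decompositions of a tree along its right branch *)

Lemma tsize_tbsl s t : tsize (tbsl s t) = tsize s + tsize t.
Proof. by elim: s => //= l _ r ->; lia. Qed.

(** Grafting on the rightmost leaf alters no left subtree. *)
Lemma bvec_tbsl s t : bvec (tbsl s t) = bvec s ++ bvec t.
Proof. by elim: s => //= l _ r ->; rewrite -catA. Qed.

(** The truncation in the right part of the splitting is harmless, because entry [j] of [b] is at
    most [j] anyway. *)
Lemma tbsl_tsplit_le p t a b : tsize a = p -> tsize a + tsize b = tsize t ->
  tam_le t (tbsl a b) = tam_le (tsplit p t).1 a && tam_le (tsplit p t).2 b.
Proof.
move=> ea eb; have le_pt : p <= tsize t by lia.
have nth_ab j : nth 0 (bvec (tbsl a b)) j =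
    if j < p then nth 0 (bvec a) j else nth 0 (bvec b) (j - p).
  by rewrite bvec_tbsl nth_cat size_bvec ea.
apply/tam_leP/andP => [h|[/tam_leP h1 /tam_leP h2] j].
  split; apply/tam_leP => j.
    rewrite nth_bvec_tsplit1 //; have := h j; rewrite nth_ab; case: ltnP => // le_pj _.
    by rewrite nth_bvec_default ?ea.
  rewrite nth_bvec_tsplit2 // leq_min nth_bvec_le andbT.
  have := h (p + j); rewrite nth_ab (_ : _ < _ = false); last lia.
  by rewrite addKn.
rewrite nth_ab; case: ltnP => [lt_jp|le_pj].
  by have := h1 j; rewrite nth_bvec_tsplit1 // lt_jp.
by have := h2 (j - p); rewrite nth_bvec_tsplit2 // leq_min subnKC // => /andP[].
Qed.

Fixpoint decs (t : tree) : seq (tree * tree) :=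
  (Leaf, t) :: (if t is Node l r then [seq (Node l ab.1, ab.2) | ab <- decs r] else [::]).

Lemma mem_decs t a b : ((a, b) \in decs t) = (tbsl a b == t).
Proof.
elim: t a b => [|l _ r IHr] a b /=.
  by rewrite inE xpair_eqE; case: a => //= *; apply/esym/eqP.
rewrite inE xpair_eqE; case: a => [|al ar] /=.
  by rewrite orbC; case: mapP => // -[[]].
apply/mapP/eqP => [[[x y] /= h [-> -> ->]]|[-> h]].
  by move: h; rewrite IHr => /eqP ->.
by exists (ar, b); rewrite ?IHr ?h.
Qed.

Lemma decs_uniq t : uniq (decs t).
Proof.
elim: t => //= l _ r IHr; rewrite map_inj_uniq ?IHr ?andbT; last first.
  by move=> [a b] [c d] [-> ->].
by apply/mapP => -[].
Qed.

(** Each block is a nonempty left comb and puts exactly one node on the right branch, so the cuts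
    fall exactly between blocks. *)
Lemma decs_Cmap c : is_comp c ->
  decs (Cmap c) = [seq (Cmap (take i c), Cmap (drop i c)) | i <- iota 0 (size c).+1].
Proof.
elim: c => //= -[|a] c IHc //= hc; rewrite -/(Cmap c) IHc //; congr (_ :: _).
rewrite -[_ :: map _ _]/(map _ (iota 0 (size c).+1)) -map_comp.
by rewrite /= -[2]/(1 + 1) (iotaDl 1 1) -map_comp.
Qed.

(** * Left leaves, subsets and compositions *)

Lemma size_leaf_flags t b : size (leaf_flags t b) = (tsize t).+1.
Proof. by elim: t b => //= l IHl r IHr b; rewrite size_cat IHl IHr; lia. Qed.

(** Leaf [i] comes just before node [i] in in-order, and is a left child exactly when that node has
    an empty left subtree. *)
Lemma nth_leaf_flags t b i : i < tsize t ->
  nth false (leaf_flags t b) i = (nth 0 (bvec t) i == 0).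
Proof.
(* The induction has to include the last leaf: it is a right child, unless the tree is a single
   leaf, which inherits [b]. *)
have: nth false (leaf_flags t b) i =
    if i < tsize t then nth 0 (bvec t) i == 0 else [&& i == tsize t, t == Leaf & b].
  elim: t b i => [|l IHl r IHr] b i; first by case: i => //= i; rewrite nth_nil.
  rewrite nth_bvec_node /= nth_cat size_leaf_flags ltnS IHl IHr.
  case: (ltngtP i (tsize l)) => h.
  - by rewrite (_ : i < _); last lia.
  - rewrite (_ : i - _ < _ = (i < (tsize l + tsize r).+1)) ?andbF //; lia.
  by rewrite h ltnS leq_addr; case: l {h IHl}.
by move=> -> ->.
Qed.

Lemma mem_Lset t i : (i \in Lset t) = (0 < i < tsize t) && (nth 0 (bvec t) i == 0).
Proof.
rewrite mem_filter mem_iota andbC (_ : (0 < i < _) = (0 < i < tsize t)); last lia.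
by case: (boolP (0 < i < _)) => // /andP[_ lt_it]; rewrite nth_leaf_flags.
Qed.

Lemma bvec_lcomb n : bvec (lcomb n) = iota 0 n.
Proof.
elim: n => // n IHn; rewrite -[n.+1 in RHS]addn1 iotaD -IHn /= -size_bvec IHn.
by rewrite size_iota.
Qed.

Lemma bvec_Cmap c : bvec (Cmap c) = flatten (map (iota 0) c).
Proof. by elim: c => //= a c IH; rewrite bvec_tbsl IH bvec_lcomb. Qed.

Lemma tsize_Cmap c : tsize (Cmap c) = sumn c.
Proof.
by rewrite -size_bvec bvec_Cmap; elim: c => //= a c IH; rewrite size_cat size_iota IH.
Qed.

Lemma nth_bvec_Cmap_succ c j : nth 0 (bvec (Cmap c)) j.+1 <> 0 ->
  nth 0 (bvec (Cmap c)) j.+1 = (nth 0 (bvec (Cmap c)) j).+1.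
Proof.
elim: c j => [|a c IH] j; first by rewrite nth_nil.
rewrite /= -/(Cmap c) bvec_tbsl bvec_lcomb !nth_cat size_iota.
case: (ltnP j.+1 a) => h1; first by rewrite (ltnW h1) !nth_iota //; lia.
case: (ltnP j a) => h2.
  have e : j.+1 - a = 0 by lia.
  by case; apply/eqP; rewrite -leqn0 -[X in _ <= X]e nth_bvec_le.
by rewrite subSn //; apply: IH.
Qed.

(* Along a block of [Cmap c] the vector grows by exactly one, which is the slowest
   growth allowed to any tree. *)
Lemma tam_le_Cmap t c : tsize t = sumn c ->
  tam_le t (Cmap c) = all (fun i => i \in Lset (Cmap c)) (Lset t).
Proof.
move=> e; apply/tam_leP/allP => [h i|h].
  rewrite !mem_Lset tsize_Cmap -e => /andP[-> /eqP h0].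
  by have := h i; rewrite h0 leqn0.
elim=> [|j IHj]; first by apply: leq_trans (nth_bvec_le _ _) _.
have [le_tj|lt_jt] := leqP (tsize t) j.+1.
  by rewrite nth_bvec_default // tsize_Cmap -e.
have [/eqP->//|nz] := boolP (nth 0 (bvec (Cmap c)) j.+1 == 0).
rewrite nth_bvec_Cmap_succ; last exact/eqP.
apply: leq_ltn_trans IHj _; apply: nth_bvec_succ; rewrite lt0n.
apply: contra nz => z; have := h j.+1; rewrite !mem_Lset lt_jt z /=.
by move=> /(_ isT) /andP[].
Qed.

Lemma mem_subseqs s t : (t \in subseqs s) = subseq t s.
Proof.
elim: s t => [|x s IHs] [|y t] //=; rewrite mem_cat IHs ?sub0seq ?orbT //.
case: eqP => [<-|ne].
  rewrite (mem_map (f := cons y)); last by move=> a b [].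
  rewrite IHs orb_idr // => h; apply: subseq_trans (subseq_cons t y) h.
by case: mapP => // -[u _ [/ne]].
Qed.

Lemma subseqs_uniq s : uniq s -> uniq (subseqs s).
Proof.
elim: s => //= x s IHs /andP[nx us]; rewrite cat_uniq IHs // andbT.
rewrite map_inj_uniq ?IHs //=; last by move=> a b [].
apply/hasPn => u; rewrite mem_subseqs => h; apply/negP => /mapP[v _ e].
by move/negP: nx; apply; apply: (mem_subseq h); rewrite e inE eqxx.
Qed.

Section SetsAndCompositions.

(** [comp_of_set] starts from [0]; the inductions need an arbitrary start. *)
Let gaps a T := pairmap (fun a b => b - a) a T.

Lemma sumn_gaps a T n : path ltn a (rcons T n) -> sumn (gaps a (rcons T n)) = n - a.
Proof.
elim: T a => [|x T IH] a /= => [|/andP[lt_ax h]]; first by lia.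
rewrite IH //; move/(order_path_min ltn_trans)/allP: h => /(_ n).
by rewrite mem_rcons inE eqxx; lia.
Qed.

(** A block of length [k] contributes the entries [0 .. k-1], so the zeros mark the starts of
    blocks. *)
Lemma nth_bvec_gaps a T n i : path ltn a (rcons T n) -> a <= i < n ->
  (nth 0 (bvec (Cmap (gaps a (rcons T n)))) (i - a) == 0) = (i \in a :: T).
Proof.
rewrite bvec_Cmap; elim: T a => [|x T IH] a /=.
  by move=> _ hi; rewrite mem_seq1 cats0 nth_iota; lia.
move=> /andP[lt_ax h] hi; rewrite nth_cat size_iota.
have gt_x y : y \in T -> x < y.
  move/(order_path_min ltn_trans)/allP: h => /(_ y) h' hy; apply: h'.
  by rewrite mem_rcons inE hy orbT.
case: ltnP => h1.
  rewrite nth_iota // !inE (_ : i == x = false); last lia.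
  by case: (boolP (i \in T)) => [/gt_x|_]; lia.
rewrite (_ : i - a - (x - a) = i - x); last lia.
rewrite IH //; last lia.
by rewrite [RHS]in_cons (_ : i == a = false) //; lia.
Qed.

Lemma subseq_iota_path T n : 0 < n -> subseq T (iota 1 n.-1) -> path ltn 0 (rcons T n).
Proof.
move=> n0 h; have s : sorted ltn (0 :: iota 1 n.-1 ++ [:: n]).
  rewrite -[n in [:: n]](prednK n0) -[[:: _]]/(iota (1 + n.-1) 1) -iotaD.
  exact: (iota_ltn_sorted 0 _.+1).
rewrite -[path _ _ _]/(sorted ltn (0 :: rcons T n)).
apply: (subseq_sorted ltn_trans _ s).
rewrite -cats1 -(cat1s 0 (T ++ _)) -(cat1s 0 (iota _ _ ++ _)).
by apply: cat_subseq => //; apply: cat_subseq.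
Qed.

Variables (n : nat) (T : seq nat).
Hypothesis subT : T \in subseqs (iota 1 n.-1).

Lemma sumn_comp_of_set : sumn (comp_of_set n T) = n.
Proof.
rewrite /comp_of_set; case: eqP => [->//|/eqP]; rewrite -lt0n => n0.
by rewrite sumn_gaps ?subn0 //; apply: subseq_iota_path; rewrite // -mem_subseqs.
Qed.

Lemma Lset_comp_of_set : Lset (Cmap (comp_of_set n T)) = T.
Proof.
have h := subT; rewrite mem_subseqs in h.
apply: (irr_sorted_eq ltn_trans ltnn).
- by apply: (subseq_sorted ltn_trans (filter_subseq _ _)); apply: iota_ltn_sorted.
- by apply: (subseq_sorted ltn_trans h); apply: iota_ltn_sorted.
move=> i; rewrite mem_Lset tsize_Cmap sumn_comp_of_set.
have [/andP[i0 ltin]|hi] /= := boolP (0 < i < n).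
  have p : path ltn 0 (rcons T n) by apply: subseq_iota_path h; lia.
  rewrite /comp_of_set (_ : n == 0 = false); last lia.
  (* Position [0] also starts a block; [0 < i] discards it. *)
  have := @nth_bvec_gaps 0 T n i p; rewrite subn0 inE (_ : i == 0 = false); last lia.
  by apply.
by apply/esym/negP => /(mem_subseq h); rewrite mem_iota; lia.
Qed.

End SetsAndCompositions.

Lemma comp_of_set_surj c : is_comp c ->
  exists2 T, T \in subseqs (iota 1 (sumn c).-1) & comp_of_set (sumn c) T = c.
Proof.
case: c => [|x c]; first by exists [::].
(* The preimage consists of the partial sums; [belast] drops the last of them, which is the
   total. *)
move=> hc; exists (belast x (scanl addn x c)); last first.
  rewrite /comp_of_set (_ : _ == 0 = false); last by move: hc => /=; lia.
  rewrite (_ : sumn _ = last x (scanl addn x c)); last first.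
    by elim: c x {hc} => [|y c IH] x /=; rewrite ?addn0 // addnA -IH.
  by rewrite -lastI -[x in x :: _]add0n -/(scanl addn 0 (x :: c)) scanlK // => a b; rewrite addKn.
pose T := belast x (scanl addn x c); set n := sumn _; rewrite -/T mem_subseqs.
have p : path ltn 0 (rcons T n).
  rewrite (_ : n = last x (scanl addn x c)); last first.
    by rewrite /n; elim: c x {hc n T} => [|y c IH] x /=; rewrite ?addn0 // addnA -IH.
  rewrite -lastI; move: hc => /= /andP[-> /=]; elim: c x {n T} => //= y c IH x /andP[y0 hc].
  by rewrite IH // -addn1 leq_add2l y0.
have sT : sorted ltn T by move: p; rewrite -cats1 cat_path => /andP[/path_sorted].
have bT i : i \in T -> 0 < i < n.
  move=> hi; have := p; rewrite path_sortedE; last exact: ltn_trans.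
  case/andP => /allP/(_ i); rewrite mem_rcons inE hi orbT => /(_ isT) i0.
  rewrite (sorted_pairwise ltn_trans) pairwise_rcons => /andP[/allP/(_ i hi) lt_in _].
  exact/andP.
suff -> : T = [seq i <- iota 1 n.-1 | i \in T] by apply: filter_subseq.
apply: (irr_sorted_eq ltn_trans ltnn) => //.
  by apply: (subseq_sorted ltn_trans (filter_subseq _ _)); apply: iota_ltn_sorted.
move=> i; rewrite mem_filter mem_iota; case: (boolP (i \in T)) => //= /bT; lia.
Qed.

(** * Permutations and the weak order *)

Lemma mem_permsn n s : (s \in permsn n) = is_perm s && (size s == n).
Proof.
rewrite mem_permutations /is_perm; apply/idP/andP => [h|[h /eqP <-//]].
have e : size s = n by rewrite (perm_size h) size_iota.
by rewrite e eqxx.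
Qed.

Lemma is_perm_uniq s : is_perm s -> uniq s.
Proof. by move=> /perm_uniq ->; apply: iota_uniq. Qed.

Lemma is_perm_nth s i : is_perm s -> i < size s -> 0 < nth 0 s i <= size s.
Proof.
by move=> h lt_is; have := mem_nth 0 lt_is; rewrite (perm_mem h) mem_iota.
Qed.

Lemma size_st s : size (st s) = size s.
Proof. exact: size_map. Qed.

Lemma nth_st s i : i < size s ->
  nth 0 (st s) i = (count (fun y => y < nth 0 s i) s).+1.
Proof. by move=> lt_is; rewrite (nth_map 0). Qed.

Lemma st_ltn s i j : i < size s -> j < size s ->
  (nth 0 (st s) i < nth 0 (st s) j) = (nth 0 s i < nth 0 s j).
Proof.
have key x y : x \in s -> x < y ->
    count (fun z => z < x) s < count (fun z => z < y) s.
  move=> xs lt_xy; rewrite -(addn0 (count _ s)) -[X in _ + X](count_pred0 s).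
  have -> : count (fun z => z < y) s =
      count (fun z => z < x) s + count (fun z => x <= z < y) s.
    rewrite -count_predUI [X in _ = _ + X](@eq_count _ _ pred0) ?count_pred0 ?addn0.
      by apply: eq_count => z /=; lia.
    by move=> z /=; lia.
  rewrite ltn_add2l count_pred0 -has_count; apply/hasP; exists x => //.
  by rewrite leqnn.
move=> hi hj; rewrite !nth_st // ltnS.
have [h|h] := ltnP (nth 0 s i) (nth 0 s j); first by rewrite key ?mem_nth.
by apply/negbTE; rewrite -leqNgt sub_count // => z /= lt_z; apply: leq_trans h.
Qed.

(** Pigeonhole: the ranks are distinct and lie in [1 .. size s], as no entry counts itself. *)
Lemma st_is_perm (s : seq nat) : uniq s -> is_perm (st s).
Proof.
move=> us; have ust : uniq (st s).
  apply/(uniqP 0) => i j; rewrite !inE size_st => hi hj e.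
  apply/eqP; rewrite -(nth_uniq 0 hi hj us).
  have := st_ltn hi hj; have := st_ltn hj hi; rewrite e ltnn => /esym h1 /esym h2.
  by rewrite eqn_leq leqNgt h1 leqNgt h2.
rewrite /is_perm size_st; have sub : {subset st s <= iota 1 (size s)}.
  move=> x /(nthP 0)[i]; rewrite size_st => hi <-; rewrite nth_st // mem_iota /=.
  rewrite add1n ltnS ltn_neqAle count_size andbT -all_count.
  by apply/allPn; exists (nth 0 s i); rewrite ?mem_nth // ltnn.
have [_ h] := uniq_min_size ust sub (eq_leq (etrans (size_iota _ _) (esym (size_st s)))).
exact: uniq_perm ust (iota_uniq _ _) h.
Qed.

Lemma eq_st s t : size s = size t ->
  (forall i j, i < size s -> j < size s ->
    (nth 0 s i < nth 0 s j) = (nth 0 t i < nth 0 t j)) -> st s = st t.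
Proof.
move=> e h; apply: (@eq_from_nth _ 0); rewrite !size_st // => i hi.
have cs p u : count p u = count (fun j => p (nth 0 u j)) (iota 0 (size u)).
  by rewrite -[in LHS](mkseq_nth 0 u) count_map.
rewrite !nth_st -?e // (cs _ s) (cs _ t) -e; congr _.+1.
apply: eq_in_count => j; rewrite mem_iota /=.
by move=> hj; rewrite h.
Qed.

Lemma st_id s : is_perm s -> st s = s.
Proof.
move=> h; apply: (@eq_from_nth _ 0); rewrite !size_st // => i hi.
rewrite nth_st // (permP h); have := is_perm_nth h hi; move: (nth _ _ _) => x hx.
have key m k : count (fun y => y < x) (iota m k) = minn k (x - m).
  by elim: k m => [|k IH] m /=; rewrite ?min0n // IH; case: ltnP; lia.
by rewrite key; lia.
Qed.

Lemma weak_leP s t : size s = size t ->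
  reflect (forall i j, i < j < size s ->
    nth 0 s j < nth 0 s i -> nth 0 t j < nth 0 t i) (weak_le s t).
Proof.
have memi u i j : ((i, j) \in inversions u) =
    (i < j < size u) && (nth 0 u j < nth 0 u i).
  rewrite mem_filter /= (_ : (i, j) \in _ = (i < size u) && (j < size u)); last first.
    apply/allpairsP/andP => [[[a b] /= [ha hb [-> ->]]]|[hi hj]].
      by move: ha hb; rewrite !mem_iota.
    by exists (i, j); rewrite !mem_iota.
  by case: (nth 0 u j < _); lia.
move=> e; apply: (iffP allP) => [h i j hij lt_s|h [i j]].
  by have := h (i, j); rewrite !memi hij lt_s => /(_ isT) /andP[].
by rewrite !memi -e => /andP[hij lt_s]; rewrite hij h.
Qed.

Lemma weak_le_refl : reflexive weak_le.
Proof. by move=> s; apply/weak_leP. Qed.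

Lemma weak_le_trans t s u : size s = size t -> size t = size u ->
  weak_le s t -> weak_le t u -> weak_le s u.
Proof.
move=> e1 e2 /(weak_leP e1) h1 /(weak_leP e2) h2.
apply/weak_leP => [|i j hij lt_s]; first by rewrite e1.
by apply: h2; rewrite -?e1 //; apply: h1.
Qed.

(** Equal inversion sets give equal comparisons at all pairs of positions; standardization depends
    on these alone and fixes permutations. *)
Lemma weak_le_anti s t : is_perm s -> is_perm t -> size s = size t ->
  weak_le s t -> weak_le t s -> s = t.
Proof.
move=> ps pt e /(weak_leP e) h1 /(weak_leP (esym e)) h2.
rewrite -(st_id ps) -(st_id pt); apply: eq_st => // i j hi hj.
have inv_eq a b : a < b < size s -> (nth 0 s b < nth 0 s a) = (nth 0 t b < nth 0 t a).
  by move=> hab; apply/idP/idP; [apply: h1|apply: h2; rewrite -e].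
have ne u a b : is_perm u -> a < size u -> b < size u -> a != b ->
    nth 0 u a != nth 0 u b by move=> /is_perm_uniq uu ha hb; rewrite nth_uniq.
case: (ltngtP i j) => hij; last by rewrite hij !ltnn.
  have := inv_eq i j; have := ne s i j ps hi hj; have := ne t i j pt; rewrite -e; lia.
by apply: inv_eq; lia.
Qed.

Lemma size_pbsl u v : size (pbsl u v) = size u + size v.
Proof. by rewrite size_cat size_map. Qed.

Lemma nth_pbsl u v i : nth 0 (pbsl u v) i =
  if i < size u then nth 0 u i + size v else nth 0 v (i - size u).
Proof. by rewrite nth_cat size_map; case: ltnP => // h; rewrite (nth_map 0). Qed.

Lemma pbsl_inj u v u' v' : size u = size u' -> size v = size v' ->
  pbsl u v = pbsl u' v' -> (u, v) = (u', v').
Proof.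
move=> eu ev /eqP; rewrite eqseq_cat ?size_map // ev => /andP[/eqP h /eqP ->].
by move: h => /(inj_map (@addIn _)) ->.
Qed.

Lemma is_perm_pbsl u v : is_perm u -> is_perm v -> is_perm (pbsl u v).
Proof.
move=> pu pv; rewrite /is_perm size_pbsl addnC iotaD perm_sym perm_catC perm_sym.
apply: perm_cat => //; rewrite addnC iotaDl.
rewrite (eq_map (g := addn (size v))) => [|x]; last exact: addnC.
exact: perm_map.
Qed.

(** A pair straddling the cut is always an inversion of [pbsl u v] and imposes no condition; the
    other pairs lie within one part, where [st] keeps comparisons. *)
Lemma pbsl_split_le s u v : is_perm s -> is_perm u -> is_perm v ->
  size s = size u + size v ->
  weak_le s (pbsl u v) =
    weak_le (st (take (size u) s)) u && weak_le (st (drop (size u) s)) v.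
Proof.
set p := size u => ps pu pv es.
have e : size s = size (pbsl u v) by rewrite size_pbsl.
have s1 : size (take p s) = p by rewrite size_takel // es leq_addr.
have s2 : size (drop p s) = size v by rewrite size_drop; lia.
have e1 : size (st (take p s)) = size u by rewrite size_st.
have e2 : size (st (drop p s)) = size v by rewrite size_st.
apply/(weak_leP e)/andP => [h|[/(weak_leP e1) h1 /(weak_leP e2) h2] i j hij].
  split; [apply/(weak_leP e1)|apply/(weak_leP e2)] => i j; rewrite ?e1 ?e2 -/p => hij.
    rewrite st_ltn ?s1; try lia.
    rewrite !nth_take; try lia.
    have := h i j; rewrite !nth_pbsl -/p (_ : j < p); last lia.
    by rewrite (_ : i < p); [rewrite ltn_add2r|]; lia.
  rewrite st_ltn ?s2 ?nth_drop; try lia.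
  have := h (p + i) (p + j); rewrite !nth_pbsl -/p !addKn.
  rewrite (_ : p + j < p = false); last lia.
  by rewrite (_ : p + i < p = false); lia.
rewrite !nth_pbsl -/p; case: (ltnP j p) => hj.
  rewrite (_ : i < p); last lia.
  have := h1 i j; rewrite e1 st_ltn ?s1 ?nth_take; rewrite -/p; lia.
case: (ltnP i p) => hi.
  have := is_perm_nth pu hi; have := @is_perm_nth v (j - p) pv; lia.
have := h2 (i - p) (j - p); rewrite e2 st_ltn ?s2 ?nth_drop ?subnKC //; lia.
Qed.

(** * Permutations of trees, trees of permutations, and their Galois connection *)

Lemma size_pvee u v : size (pvee u v) = (size u + size v).+1.
Proof. by rewrite size_cat size_map /= addnS. Qed.

Lemma pveeE u v : pvee u v = pbsl (rcons u (size u).+1) v.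
Proof. by rewrite /pbsl map_rcons cat_rcons. Qed.

Lemma is_perm_pvee u v : is_perm u -> is_perm v -> is_perm (pvee u v).
Proof.
move=> pu pv; rewrite pveeE; apply: is_perm_pbsl => //.
by rewrite /is_perm -cats1 size_cat iotaD; apply: perm_cat.
Qed.

Lemma size_gamma t : size (gamma t) = tsize t.
Proof. by elim: t => //= l IHl r IHr; rewrite size_pvee IHl IHr. Qed.

Lemma is_perm_gamma t : is_perm (gamma t).
Proof. by elim: t => //= l IHl r IHr; apply: is_perm_pvee. Qed.

(** In [pvee u v] the maximum and the letters of [u] exceed those of [v], so a pair not inside one
    of [u], [v] is a non-inversion only when [j] is the root. The right-hand side places [i] in the
    interval just before [j] that forms its left subtree. *)
Lemma gamma_noninv t i j : i < j < tsize t ->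
  (nth 0 (gamma t) i < nth 0 (gamma t) j) = (j <= i + nth 0 (bvec t) j).
Proof.
elim: t i j => [|l IHl r IHr] i j; first by rewrite ltn0 andbF.
rewrite nth_bvec_node [gamma _]/= [tsize _]/= => hij.
rewrite pveeE !nth_pbsl !nth_rcons size_rcons !size_gamma.
have bd t k : k < tsize t -> 0 < nth 0 (gamma t) k <= tsize t.
  by rewrite -size_gamma; apply/is_perm_nth/is_perm_gamma.
have := bd l i; have := bd l j; have := bd r (j - (tsize l).+1).
have := nth_bvec_le r (j - (tsize l).+1).
case: (ltngtP j (tsize l)) => hj.
- rewrite (_ : i < (tsize l).+1); last lia.
  rewrite (_ : j < (tsize l).+1); last lia.
  rewrite (_ : i < tsize l); last lia.
  by rewrite ltn_add2r IHl //; lia.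
- rewrite (_ : j < (tsize l).+1 = false); last lia.
  case: (ltnP i (tsize l).+1) => hi; first by case: (ltngtP i (tsize l)); lia.
  by rewrite IHr; lia.
rewrite hj ltnSn (_ : i < tsize l); last lia.
by rewrite (_ : i < (tsize l).+1); lia.
Qed.

Lemma gamma_inj : injective gamma.
Proof.
move=> s t e; have es : tsize s = tsize t by rewrite -!size_gamma e.
apply: bvec_inj; apply: (@eq_from_nth _ 0); rewrite ?size_bvec // => j hj.
have h i : i < j -> (j <= i + nth 0 (bvec s) j) = (j <= i + nth 0 (bvec t) j).
  by move=> hi; rewrite -!gamma_noninv ?e -?es // hi.
(* Unequal entries are told apart by the first node of one of the two left subtrees of [j]. *)
have := nth_bvec_le s j; have := nth_bvec_le t j.
have := h (j - nth 0 (bvec s) j); have := h (j - nth 0 (bvec t) j); lia.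
Qed.

Lemma gamma_tbsl s t : gamma (tbsl s t) = pbsl (gamma s) (gamma t).
Proof.
elim: s => [|l IHl r IHr] //=; rewrite IHr !pveeE /pbsl !map_cat -!map_comp -catA.
congr (_ ++ _); rewrite size_cat size_map.
by apply: eq_map => x /=; rewrite addnA.
Qed.

Lemma gamma_Cmap c : gamma (Cmap c) = Zmap c.
Proof.
elim: c => //= a c IH; rewrite gamma_tbsl IH; congr pbsl.
elim: a => // a IHa; rewrite [gamma _]/= IHa pveeE /pbsl cats0 (eq_map (g := id)) ?map_id.
  by rewrite /idp size_iota -cats1 -[in RHS](addn1 a) (iotaD 1 a 1).
exact: addn0.
Qed.

(** Letters being distinct, inclusion of inversions is reverse inclusion of non-inversions, and
    [gamma_noninv] gives those of [gamma t]. *)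
Lemma weak_le_gamma s t : is_perm s -> size s = tsize t ->
  reflect (forall i j, i < j < size s -> j <= i + nth 0 (bvec t) j ->
    nth 0 s i < nth 0 s j) (weak_le s (gamma t)).
Proof.
move=> ps e; have e' : size s = size (gamma t) by rewrite size_gamma.
have ne u i j : is_perm u -> i < j < size u -> nth 0 u i <> nth 0 u j :> nat.
  move=> /is_perm_uniq uu /andP[lt_ij lt_j]; apply/eqP.
  by rewrite nth_uniq ?ltn_eqF // (ltn_trans lt_ij).
apply: (iffP (weak_leP e')) => h i j hij.
  have hij' : i < j < tsize t by rewrite -e.
  rewrite -(gamma_noninv hij') => lt_g; have := h i j hij; have := ne s i j ps hij; lia.
have hij' : i < j < tsize t by rewrite -e.
have := h i j hij; rewrite -(gamma_noninv hij').
have := ne _ i j (is_perm_gamma t); rewrite -e'; lia.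
Qed.

Lemma bigmax_mem (s : seq nat) : s != [::] -> \max_(x <- s) x \in s.
Proof.
elim: s => // x s IH _; rewrite big_cons inE.
case: s IH => [_|y s IH]; first by rewrite big_nil maxn0 eqxx.
case: (leqP (\max_(z <- y :: s) z) x) => h; first by rewrite eqxx.
by rewrite IH ?orbT.
Qed.

(** Entry [j] is the length of the longest run of smaller letters ending just before [j]. For the
    maximum, which becomes the root, the run is everything before it; no run starting from the right
    part crosses it; and [st] keeps comparisons in both parts. The bound on [k] provides the
    fuel. *)
Lemma lam_recP k (s : seq nat) : size s <= k -> uniq s ->
  tsize (lam_rec k s) = size s /\
  forall i j, i < j < size s ->
    (forall h, i <= h < j -> nth 0 s h < nth 0 s j) <->
    j <= i + nth 0 (bvec (lam_rec k s)) j.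
Proof.
elim: k s => [|k IHk] s; first by case: s => // _ _; split=> // i j; rewrite ltn0 andbF.
move=> le_sk us; case: (eqVneq s [::]) => [->|nes].
  by split=> // i j; rewrite ltn0 andbF.
have -> : lam_rec k.+1 s = let j := index (\max_(x <- s) x) s in
    Node (lam_rec k (st (take j s))) (lam_rec k (st (drop j.+1 s))) by case: (s) nes.
cbv zeta; set m := \max_(x <- s) x; set r := index m s.
have ms : m \in s by apply: bigmax_mem.
have lt_rs : r < size s by rewrite index_mem.
have nr : nth 0 s r = m by apply: nth_index.
have lt_m i : i < size s -> i != r -> nth 0 s i < m.
  move=> hi ne; have le_m : nth 0 s i <= m.
    by rewrite /m (bigD1_seq (nth 0 s i)) ?mem_nth //= leq_maxl.
  by rewrite ltn_neqAle le_m andbT -nr nth_uniq.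
set A := take r s; set B := drop r.+1 s.
have sA : size A = r by rewrite size_take lt_rs.
have sB : size B = size s - r.+1 by rewrite size_drop.
have uA : uniq A by apply: take_uniq.
have uB : uniq B by apply: drop_uniq.
have leA : size (st A) <= k by rewrite size_st sA; lia.
have leB : size (st B) <= k by rewrite size_st sB leq_subLR; lia.
have [tA bA] : _ /\ _ := IHk (st A) leA (is_perm_uniq (st_is_perm uA)).
have [tB bB] : _ /\ _ := IHk (st B) leB (is_perm_uniq (st_is_perm uB)).
rewrite !size_st in tA tB bA bB.
split=> [|i j hij]; first by rewrite /= tA tB sA sB; lia.
rewrite -/(bvec (Node _ _)) nth_bvec_node tA sA.
case: (ltngtP j r) => hj.
- rewrite -bA; last lia.
  split=> h g hg; have := h g hg; rewrite st_ltn ?nth_take //; lia.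
- have le_b := nth_bvec_le (lam_rec k (st B)) (j - r.+1).
  have ngt : nth 0 s j < m by apply: lt_m; lia.
  (* If [i <= r < j] both sides fail: position [r] carries the maximum, and the left subtree of [j]
     stays to the right of [r]. *)
  have [le_ir|lt_ri] := leqP i r.
    split=> [h|]; last lia.
    by have := h r; rewrite nr; lia.
  rewrite (_ : j <= i + nth 0 (bvec (lam_rec k (st B))) (j - r.+1) <->
           j - r.+1 <= i - r.+1 + nth 0 (bvec (lam_rec k (st B))) (j - r.+1)); last first.
    by split; lia.
  rewrite -bB; last lia.
  have tr g : r < g -> g < j ->
      (nth 0 (st B) (g - r.+1) < nth 0 (st B) (j - r.+1)) = (nth 0 s g < nth 0 s j).
    by move=> h1 h2; rewrite st_ltn ?nth_drop ?subnKC //; lia.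
  split=> h g hg; last by rewrite -tr; [apply: h|..]; lia.
  by have := h (g + r.+1); rewrite -tr ?addnK; lia.
split=> [_|_ g hg]; first lia.
by rewrite hj nr; apply: lt_m; lia.
Qed.

Lemma tsize_lambda (s : seq nat) : uniq s -> tsize (lambda s) = size s.
Proof. by move=> us; have [] := lam_recP (leqnn _) us. Qed.

Lemma bvec_lambda (s : seq nat) i j : uniq s -> i < j < size s ->
  (forall h, i <= h < j -> nth 0 s h < nth 0 s j) <->
  j <= i + nth 0 (bvec (lambda s)) j.
Proof. by move=> us; have [_] := lam_recP (leqnn _) us; apply. Qed.

(** Both sides say that, for every [j], the left subtree of node [j] in [t] is within the run of
    smaller letters before position [j] of [s]. *)
Lemma lambda_gamma_galois s t : is_perm s -> size s = tsize t ->
  weak_le s (gamma t) = tam_le (lambda s) t.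
Proof.
move=> ps e; have us := is_perm_uniq ps.
apply/(weak_le_gamma ps e)/tam_leP => [h j|h i j hij le_j].
  have [->//|b0] := posnP (nth 0 (bvec t) j).
  have [le_tj|lt_jt] := leqP (tsize t) j; first by rewrite nth_bvec_default in b0.
  have := nth_bvec_le t j => le_b.
  (* This is the first node of the left subtree of [j], the farthest point the run has to reach. *)
  have hij : j - nth 0 (bvec t) j < j < size s by lia.
  have [h1 _] := bvec_lambda us hij.
  suff: j <= j - nth 0 (bvec t) j + nth 0 (bvec (lambda s)) j by lia.
  by apply: h1 => g hg; apply: h; lia.
have [_ h2] := bvec_lambda us hij.
by apply: h2; have := h j; lia.
Qed.

(** The run of smaller letters before position [i] is empty exactly when the preceding letter is
    larger. *)
Lemma Lset_lambda s : is_perm s -> Lset (lambda s) = Des s.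
Proof.
move=> ps; have us := is_perm_uniq ps.
rewrite /Lset /Des tsize_lambda //; apply/eq_in_filter => i; rewrite mem_iota => hi.
rewrite nth_leaf_flags ?tsize_lambda //; last lia.
have hij : i.-1 < i < size s by lia.
have [h1 h2] := bvec_lambda us hij.
have lt_i : i < size s by lia.
have lt_i1 : i.-1 < size s by lia.
have ne : nth 0 s i != nth 0 s i.-1 by rewrite nth_uniq //; lia.
rewrite ltn_neqAle ne leqNgt /=; apply/eqP/idP => [e|/negP lt_n].
  apply/negP => lt_s; have : i <= i.-1 + 0.
    by rewrite -e; apply: h1 => g hg; rewrite (_ : g = i.-1) //; lia.
  by lia.
apply/eqP; rewrite eqn0Ngt; apply/negP => b0; apply: lt_n; apply: h2; lia.
Qed.

(** Cut [t] at [p = size u]. Pairs straddling the cut are inversions of [pbsl u v], so no left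
    subtree of a later node reaches across it, and the two parts recompose to [t]. *)
Lemma pbsl_gamma u v t : is_perm u -> is_perm v -> pbsl u v = gamma t ->
  exists2 ab, ab \in decs t & (u, v) = (gamma ab.1, gamma ab.2).
Proof.
move=> pu pv e; set p := size u.
have es : size u + size v = tsize t by rewrite -size_pbsl e size_gamma.
have le_pt : p <= tsize t by rewrite -es leq_addr.
pose a := (tsplit p t).1; pose b := (tsplit p t).2.
have sa : tsize a = p by apply: tsize_tsplit1.
have sb : tsize b = size v by rewrite tsize_tsplit2 // -es addKn.
have eab : tbsl a b = t.
  apply: bvec_inj; rewrite bvec_tbsl; apply: (@eq_from_nth _ 0).
    by rewrite size_cat !size_bvec sa sb.
  rewrite size_cat !size_bvec sa sb => j hj; rewrite nth_cat size_bvec sa.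
  case: ltnP => h; first by rewrite nth_bvec_tsplit1 // h.
  rewrite nth_bvec_tsplit2 // subnKC //; apply/minn_idPl.
  (* A left subtree is an interval ending just before its node, so excluding node [p - 1] suffices;
     for [p = 0] there is nothing to exclude. *)
  have [p0|p0] := posnP p; first by rewrite p0 subn0 nth_bvec_le.
  have := @gamma_noninv t p.-1 j; rewrite -e !nth_pbsl -/p.
  rewrite (_ : p.-1 < p); last lia.
  rewrite (_ : j < p = false); last lia.
  have := @is_perm_nth u p.-1 pu; have := @is_perm_nth v (j - p) pv; rewrite -/p; lia.
exists (a, b); first by rewrite mem_decs eab.
apply: pbsl_inj; rewrite ?size_gamma ?sa ?sb //.
by rewrite e -eab gamma_tbsl.
Qed.

(** * Moebius inversion and free modules *)

Local Open Scope ring_scope.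

Section Mobius.

Variables (T : finType) (le : rel T).
Hypotheses (le_refl : reflexive le) (le_anti : antisymmetric le)
  (le_trans : transitive le).

(** Induction on the size of the down-set of [y]: since [P] is an up-set, all points below [y] are
    outside [P], so the sum reduces to [w y]. It serves with [P] empty, for the invertibility of the
    zeta matrix, and with [P] the up-set of a point, for the support of the Moebius function. *)
Lemma eq0_of_downsums (P : pred T) (w : T -> rat) :
  (forall y z, P y -> le y z -> P z) ->
  (forall y, ~~ P y -> \sum_(z | le z y) w z = 0) ->
  forall y, ~~ P y -> w y = 0.
Proof.
move=> upP sum0 y.
elim: {y}#|[pred z | le z y]|.+1 {-2}y (ltnSn #|[pred z | le z y]|) => // n IHn y.
rewrite ltnS => le_yn nPy; have := sum0 y nPy.
rewrite (bigD1 y) //= big1 ?addr0 // => z /andP[le_zy ne_zy].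
apply: IHn; last by apply: contra nPy => Pz; apply: upP le_zy.
apply: leq_trans le_yn; apply: proper_card; apply/properP; split.
  by apply/subsetP => u; rewrite !inE => le_uz; apply: le_trans le_zy.
exists y; rewrite !inE //; apply: contra ne_zy => le_yz.
by apply/eqP/le_anti; rewrite le_zy.
Qed.

Let Z : 'M[rat]_#|T| := \matrix_(i, j) (le (enum_val i) (enum_val j))%:R.

Lemma big_enum_rank (V : nmodType) (F : 'I_#|T| -> V) :
  \sum_i F i = \sum_x F (enum_rank x).
Proof. by rewrite (reindex enum_rank) //; apply/onW_bij/enum_rank_bij. Qed.

Lemma zeta_unit : Z \in unitmx.
Proof.
rewrite -row_free_unit; apply: inj_row_free => v vZ0; apply/rowP => i.
rewrite mxE -(enum_valK i); move: (enum_val i) => x.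
apply: (@eq0_of_downsums pred0 (fun x => v 0 (enum_rank x))) => // y _.
have := congr1 (fun m : 'rV_#|T| => m 0 (enum_rank y)) vZ0.
rewrite !mxE big_enum_rank => vZ; rewrite -[RHS]vZ big_mkcond /=.
apply: eq_bigr => z _; rewrite mxE !enum_rankK.
by case: (le z y); rewrite ?mulr1 ?mulr0.
Qed.

Lemma mobius_zeta x z : \sum_(y | le y z) mobius le x y = (x == z)%:R.
Proof.
have := congr1 (fun m : 'M_#|T| => m (enum_rank x) (enum_rank z)) (mulVmx zeta_unit).
rewrite !mxE (inj_eq enum_rank_inj) big_enum_rank => <-; rewrite big_mkcond /=.
apply: eq_bigr => y _; rewrite mxE !enum_rankK.
by case: (le y z); rewrite ?mulr1 ?mulr0.
Qed.

Lemma zeta_mobius x z : \sum_(y | le x y) mobius le y z = (x == z)%:R.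
Proof.
have := congr1 (fun m : 'M_#|T| => m (enum_rank x) (enum_rank z)) (mulmxV zeta_unit).
rewrite !mxE (inj_eq enum_rank_inj) big_enum_rank => <-; rewrite big_mkcond /=.
apply: eq_bigr => y _; rewrite mxE !enum_rankK.
by case: (le x y); rewrite ?mul1r ?mul0r.
Qed.

Lemma mobius_eq0 x y : ~~ le x y -> mobius le x y = 0.
Proof.
move: y; apply: (@eq0_of_downsums (le x)) => [y z|y nle_xy]; first exact: le_trans.
by rewrite mobius_zeta; case: eqP nle_xy => // ->; rewrite le_refl.
Qed.

(** Dropping the range condition makes the sums free to be exchanged. *)
Lemma mobius_sum (V : lmodType rat) x (h : T -> V) :
  \sum_(y | le x y) mobius le x y *: h y = \sum_y mobius le x y *: h y.
Proof.
rewrite big_mkcond /=; apply: eq_bigr => y _; case: ifPn => // /mobius_eq0 ->.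
by rewrite scale0r.
Qed.

Lemma mobius_inversion (V : lmodType rat) (h k : T -> V) :
  (forall x, h x = \sum_(y | le x y) k y) ->
  forall x, \sum_(y | le x y) mobius le x y *: h y = k x.
Proof.
move=> hE x; rewrite mobius_sum.
under eq_bigr => y _ do rewrite hE scaler_sumr.
rewrite (exchange_big_dep predT) //=.
under eq_bigr => z _ do rewrite -scaler_suml mobius_zeta.
rewrite (bigD1 x) //= eqxx scale1r big1 ?addr0 // => z /negbTE.
by rewrite eq_sym => ->; rewrite scale0r.
Qed.

Lemma mobius_expansion (V : lmodType rat) (h : T -> V) x :
  h x = \sum_(y | le x y) \sum_(z | le y z) mobius le y z *: h z.
Proof.
under eq_bigr => y _ do rewrite mobius_sum.
rewrite exchange_big /=.
under eq_bigr => z _ do rewrite -scaler_suml zeta_mobius.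
rewrite (bigD1 x) //= eqxx scale1r big1 ?addr0 // => z /negbTE.
by rewrite eq_sym => ->; rewrite scale0r.
Qed.

End Mobius.

Lemma big_seq_sub (V : nmodType) (I : choiceType) (l : seq I) (P : pred I) (F : I -> V) :
  uniq l -> \sum_(u : seq_sub l | P (val u)) F (val u) = \sum_(u <- l | P u) F u.
Proof.
move=> ul; rewrite -(big_map val P F); apply: perm_big; apply: uniq_perm => //.
  by rewrite map_inj_uniq ?index_enum_uniq //; apply: val_inj.
move=> u; apply/mapP/idP => [[x _ ->]|lu]; first exact: (valP x).
by exists (SeqSub lu) => //; rewrite mem_index_enum.
Qed.

(** * Linear maps on free modules and tensor products *)

Section FreegLinear.

Variables (K : choiceType) (V : lmodType rat) (f : K -> V).

HB.instance Definition _ :=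
  GRing.isAdditive.Build {freeg K / rat} V (fglift f) (lift_is_additive f).

Lemma fglift_is_scalable : scalable (fglift f).
Proof.
move=> c D; rewrite -[in RHS](freeg_sumE D) -[c *: D]/(fgscale c D) /fgscale !raddf_sum.
by apply: eq_bigr => x _ /=; rewrite !liftU scalerA.
Qed.

HB.instance Definition _ :=
  GRing.isScalable.Build rat {freeg K / rat} V *:%R (fglift f) fglift_is_scalable.

Lemma fglift1 x : fglift f << x >> = f x.
Proof. by rewrite liftU scale1r. Qed.

Lemma freeg_sum1E (D : {freeg K / rat}) :
  D = \sum_(x <- dom D) coeff x D *: << x >>.
Proof.
rewrite -[LHS]freeg_sumE; apply: eq_bigr => x _; apply/eqP/freeg_eqP => y.
by rewrite coeffZ !coeffU mul1r.
Qed.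

Lemma fgliftE D : fglift f D = \sum_(x <- dom D) coeff x D *: f x.
Proof.
rewrite [in LHS](freeg_sum1E D) linear_sum; apply: eq_bigr => x _.
by rewrite linearZ /= fglift1.
Qed.

Lemma freeg_linear_ext (g h : {linear {freeg K / rat} -> V}) :
  (forall x, g << x >> = h << x >>) -> g =1 h.
Proof.
move=> e D; rewrite (freeg_sum1E D) !linear_sum; apply: eq_bigr => x _.
by rewrite !linearZ /= e.
Qed.

End FreegLinear.

Section Tensor.

Variables (K1 K2 : choiceType).
Implicit Types (u : {freeg K1 / rat}) (v : {freeg K2 / rat}).

Lemma tens11 (x : K1) (y : K2) : tens << x >> << y >> = << (x, y) >>.
Proof. by rewrite /tens !fglift1. Qed.

(* Exchanging the arguments lets linearity in the left factor be a canonical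
   instance. *)
Definition tensl v u := tens u v.
HB.instance Definition _ v := GRing.Linear.copy (tensl v)
  (fglift (fun x : K1 => fglift (fun y : K2 => << (x, y) >> : {freeg (K1 * K2)%type / rat}) v)).

Lemma tens_is_linear u : linear (@tens K1 K2 u).
Proof.
move=> c v w; rewrite /tens !fgliftE scaler_sumr -big_split /=; apply: eq_bigr => x _.
by rewrite linearP scalerDr scalerA scalerA mulrC.
Qed.
HB.instance Definition _ u := GRing.isLinear.Build rat
  {freeg K2 / rat} {freeg (K1 * K2)%type / rat} *:%R (@tens K1 K2 u) (tens_is_linear u).

Lemma tens_sum (I J : Type) (r : seq I) (s : seq J) (P : pred I) (Q : pred J)
    (F : I -> {freeg K1 / rat}) (G : J -> {freeg K2 / rat}) :
  tens (\sum_(i <- r | P i) F i) (\sum_(j <- s | Q j) G j) =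
  \sum_(i <- r | P i) \sum_(j <- s | Q j) tens (F i) (G j).
Proof.
rewrite -[LHS]/(tensl _ _) linear_sum; apply: eq_bigr => i _.
by rewrite /= /tensl linear_sum.
Qed.

Variables (K3 K4 : choiceType).
Variables (f : {freeg K1 / rat} -> {freeg K3 / rat}).
Variables (g : {freeg K2 / rat} -> {freeg K4 / rat}).

HB.instance Definition _ := GRing.Linear.copy (tmap f g)
  (fglift (fun p : K1 * K2 => tens (f << p.1 >>) (g << p.2 >>))).

Lemma tmap1 p : tmap f g << p >> = tens (f << p.1 >>) (g << p.2 >>).
Proof. exact: fglift1. Qed.

End Tensor.

Lemma tmap_tens (K1 K2 K3 K4 : choiceType)
    (f : {linear {freeg K1 / rat} -> {freeg K3 / rat}})
    (g : {linear {freeg K2 / rat} -> {freeg K4 / rat}}) u v :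
  tmap f g (tens u v) = tens (f u) (g v).
Proof.
(* Bilinear extension in two stages: [h] has a basis vector on the left and extends in the right
   factor; the left factor is extended afterwards. *)
suff h x : (tmap f g \o tens << x >>) =1 (tens (f << x >>) \o g).
  by apply: (freeg_linear_ext (g := tmap f g \o tensl v) (h := tensl (g v) \o f)) => x;
    apply: (h x v).
by apply: freeg_linear_ext => y /=; rewrite tens11 tmap1.
Qed.

HB.instance Definition _ := GRing.Linear.copy DeltaS (fglift (fun x : perm_key =>
    \sum_(p < (size (val x)).+1)
      << (mkperm (st (take p (val x))), mkperm (st (drop p (val x)))) >>
      : {freeg (perm_key * perm_key)%type / rat})).
HB.instance Definition _ := GRing.Linear.copy epsS
  (fglift (fun x : perm_key => ((size (val x) == 0%N)%:R : rat^o))).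
HB.instance Definition _ := GRing.Linear.copy DeltaY (fglift (fun t : tree =>
    \sum_(ab <- splits t) << ab >> : {freeg (tree * tree)%type / rat})).
HB.instance Definition _ := GRing.Linear.copy epsY
  (fglift (fun t : tree => ((t == Leaf)%:R : rat^o))).
HB.instance Definition _ := GRing.Linear.copy DeltaQ (fglift (fun c : comp_key =>
    \sum_(i < (size (val c)).+1)
      << (mkcomp (take i (val c)), mkcomp (drop i (val c))) >>
      : {freeg (comp_key * comp_key)%type / rat})).
HB.instance Definition _ := GRing.Linear.copy epsQ
  (fglift (fun c : comp_key => ((val c == [::])%:R : rat^o))).
HB.instance Definition _ := GRing.Linear.copy LambdaM
  (fglift (fun x : perm_key => FY (lambda (val x)))).
HB.instance Definition _ := GRing.Linear.copy LM
  (fglift (fun t : tree => FQ (tsize t) (Lset t))).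
HB.instance Definition _ := GRing.Linear.copy DM
  (fglift (fun x : perm_key => FQ (size (val x)) (Des (val x)))).
HB.instance Definition _ := GRing.Linear.copy CM
  (fglift (fun c : comp_key => MY (Cmap (val c)))).
HB.instance Definition _ := GRing.Linear.copy ZM
  (fglift (fun c : comp_key => MS (Zmap (val c)))).

(** * Monomial bases *)

Lemma val_mkperm s : is_perm s -> val (mkperm s) = s.
Proof. exact: insubdK. Qed.

Lemma mkcompK (c : comp_key) : mkcomp (val c) = c.
Proof. exact: valKd. Qed.

Lemma val_mkcomp c : is_comp c -> val (mkcomp c) = c.
Proof. exact: insubdK. Qed.

Section WeakMobius.

Variable n : nat.

Lemma PermN_is_perm (a : PermN n) : is_perm (val a).
Proof. by have := valP a; rewrite mem_permsn => /andP[]. Qed.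

Lemma PermN_size (a : PermN n) : size (val a) = n.
Proof. by have := valP a; rewrite mem_permsn => /andP[_ /eqP]. Qed.

Lemma weak_leN_refl : reflexive (@weak_leN n).
Proof. by move=> a; apply: weak_le_refl. Qed.

Lemma weak_leN_anti : antisymmetric (@weak_leN n).
Proof.
move=> a b /andP[h1 h2]; apply: val_inj.
by apply: weak_le_anti h1 h2; rewrite ?PermN_is_perm ?PermN_size.
Qed.

Lemma weak_leN_trans : transitive (@weak_leN n).
Proof. by move=> b a c; apply: weak_le_trans; rewrite !PermN_size. Qed.

Lemma permsn_uniq : uniq (permsn n).
Proof. exact: permutations_uniq. Qed.

Lemma MS_expansion s : s \in permsn n ->
  FS s = \sum_(u <- permsn n | weak_le s u) MS u.
Proof.
move=> hs; rewrite -(big_seq_sub _ _ permsn_uniq).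
rewrite [LHS](mobius_expansion weak_leN_refl weak_leN_anti weak_leN_trans
  (fun u : PermN n => FS (val u)) (SeqSub hs)).
apply: eq_bigr => u _; rewrite /MS.
(* [MS] takes its degree from the size of its argument, which is only provably equal to [n]; a
   variable [m] makes the substitution possible. *)
suff key m (e : m = n) : \sum_(z | weak_leN u z) mobius (@weak_leN n) u z *: FS (val z) =
    \sum_(v | weak_leN (to_permn m (val u)) v)
      mobius (@weak_leN m) (to_permn m (val u)) v *: FS (val v).
  exact/key/PermN_size.
by subst m; rewrite /to_permn valKd.
Qed.

(** With this lemma and [MY_linear], coproducts, counits and projections are computed on the F basis
    as sums over up-sets, without handling [mobius]. *)
Lemma MS_linear (V : lmodType rat) (f : {linear SSym -> V}) (k : seq nat -> V) :
  (forall s, s \in permsn n -> f (FS s) = \sum_(u <- permsn n | weak_le s u) k u) ->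
  forall s, s \in permsn n -> f (MS s) = k s.
Proof.
move=> fF s hs; have := mobius_inversion weak_leN_refl weak_leN_anti weak_leN_trans
  (h := fun u : PermN n => f (FS (val u))) (k := fun u => k (val u)).
move=> /(_ _ (SeqSub hs)) /= <-; last first.
  by move=> u; rewrite fF ?(valP u) // -(big_seq_sub _ _ permsn_uniq).
rewrite /MS; suff key m (e : m = n) : f (\sum_(v | weak_leN (to_permn m s) v)
      mobius (@weak_leN m) (to_permn m s) v *: FS (val v)) =
    \sum_(y | weak_leN (SeqSub hs) y) mobius (@weak_leN n) (SeqSub hs) y *: f (FS (val y)).
  by apply: key; have := PermN_size (SeqSub hs).
subst m; rewrite (_ : to_permn n s = SeqSub hs); last exact: (valKd _ (SeqSub hs : PermN n)).
by rewrite linear_sum; apply: eq_bigr => v _; rewrite linearZ.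
Qed.

End WeakMobius.

Section TamariMobius.

Variable n : nat.

Lemma TreeN_tsize (a : TreeN n) : tsize (val a) = n.
Proof. by have := valP a; rewrite treesn_mem => /eqP. Qed.

Lemma tam_leN_refl : reflexive (@tam_leN n).
Proof. by move=> a; rewrite tam_leNE tam_le_refl. Qed.

Lemma tam_leN_anti : antisymmetric (@tam_leN n).
Proof.
move=> a b; rewrite !tam_leNE => /andP[h1 h2]; apply: val_inj.
by apply: tam_le_anti h1 h2; rewrite !TreeN_tsize.
Qed.

Lemma tam_leN_trans : transitive (@tam_leN n).
Proof. by move=> b a c; rewrite !tam_leNE; apply: tam_le_trans. Qed.

Lemma sum_TreeN (V : nmodType) (x : TreeN n) (F : tree -> V) :
  \sum_(u | tam_leN x u) F (val u) = \sum_(u <- treesn n | tam_le (val x) u) F u.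
Proof.
rewrite -(big_seq_sub _ _ (treesn_uniq n)); apply: eq_bigl => u.
exact: tam_leNE.
Qed.

Lemma MY_expansion t : t \in treesn n ->
  FY t = \sum_(u <- treesn n | tam_le t u) MY u.
Proof.
move=> ht; rewrite -(sum_TreeN (SeqSub ht : TreeN n)).
rewrite [LHS](mobius_expansion tam_leN_refl tam_leN_anti tam_leN_trans
  (fun u : TreeN n => FY (val u)) (SeqSub ht)).
apply: eq_bigr => u _; rewrite /MY.
suff key m (e : m = n) : \sum_(z | tam_leN u z) mobius (@tam_leN n) u z *: FY (val z) =
    \sum_(v | tam_leN (to_treen m (val u)) v)
      mobius (@tam_leN m) (to_treen m (val u)) v *: FY (val v).
  exact/key/TreeN_tsize.
by subst m; rewrite /to_treen valKd.
Qed.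

Lemma MY_linear (V : lmodType rat) (f : {linear YSym -> V}) (k : tree -> V) :
  (forall t, t \in treesn n -> f (FY t) = \sum_(u <- treesn n | tam_le t u) k u) ->
  forall t, t \in treesn n -> f (MY t) = k t.
Proof.
move=> fF t ht; have := mobius_inversion tam_leN_refl tam_leN_anti tam_leN_trans
  (h := fun u : TreeN n => f (FY (val u))) (k := fun u => k (val u)).
move=> /(_ _ (SeqSub ht)) /= <-; last first.
  by move=> u; rewrite fF ?(valP u) // sum_TreeN.
rewrite /MY; suff key m (e : m = n) : f (\sum_(v | tam_leN (to_treen m t) v)
      mobius (@tam_leN m) (to_treen m t) v *: FY (val v)) =
    \sum_(y | tam_leN (SeqSub ht) y) mobius (@tam_leN n) (SeqSub ht) y *: f (FY (val y)).
  by apply: key; have := TreeN_tsize (SeqSub ht).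
subst m; rewrite (_ : to_treen n t = SeqSub ht); last exact: (valKd _ (SeqSub ht : TreeN n)).
by rewrite linear_sum; apply: eq_bigr => v _; rewrite linearZ.
Qed.

End TamariMobius.

(** The [MY t] span, since [MY_expansion] writes every [FY t] in terms of them. *)
Lemma YSym_linear_ext (V : lmodType rat) (f g : {linear YSym -> V}) :
  (forall t, f (MY t) = g (MY t)) -> f =1 g.
Proof.
move=> e; apply: freeg_linear_ext => t; have ht : t \in treesn (tsize t) by rewrite treesn_mem.
rewrite -[<< t >>]/(FY t) (MY_expansion ht) !linear_sum; apply: eq_bigr => u _.
exact: e.
Qed.

(** * Regrouping graded sums over pairs *)

Section GradedPairs.

Variables (I : eqType) (E : nat -> seq I) (sz : I -> nat) (V : nmodType) (h : I -> I -> V).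
Hypothesis E_uniq : forall n, uniq (E n).
Hypothesis E_size : forall n x, x \in E n -> sz x = n.

Lemma sum_pick (J : eqType) (r : seq J) (P : pred J) j (F : J -> V) : uniq r ->
  \sum_(i <- r | P i && (i == j)) F i = if (j \in r) && P j then F j else 0.
Proof.
move=> ur; have [jr|njr] /= := boolP (j \in r); last first.
  rewrite big_seq_cond big1 // => i /and3P[ir _ /eqP ij].
  by rewrite -ij ir in njr.
rewrite -big_filter; case: ifP => Pj.
  rewrite (bigD1_seq j) ?filter_uniq //= ?mem_filter ?Pj ?eqxx // big_filter_cond.
  by rewrite big1 ?addr0 // => i /andP[/andP[_ ->]].
by rewrite big_filter big1 // => i /andP[Pi /eqP ij]; rewrite -ij Pi in Pj.
Qed.

(** Common core of the coproducts on trees and on permutations: [c p] and [d p] are the two parts of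
    [x]. The Galois connection merges the conditions on [a] and [b] into one on [bsl a b], by which
    the pairs are then grouped. *)
Lemma sum_splittings (le : rel I) (bsl : I -> I -> I) n x (c d : nat -> I) :
  (forall p a b, (p <= n)%N -> a \in E p -> b \in E (n - p) -> bsl a b \in E n) ->
  (forall p a b, (p <= n)%N -> a \in E p -> b \in E (n - p) ->
     le x (bsl a b) = le (c p) a && le (d p) b) ->
  \sum_(p < n.+1) \sum_(a <- E p | le (c p) a) \sum_(b <- E (n - p)%N | le (d p) b) h a b =
  \sum_(y <- E n | le x y)
    \sum_(p < n.+1) \sum_(a <- E p) \sum_(b <- E (n - p)%N | bsl a b == y) h a b.
Proof.
move=> bslE leE; rewrite [RHS]exchange_big /=; apply: eq_bigr => -[p /= lt_pn] _.
rewrite ltnS in lt_pn; rewrite [RHS]exchange_big /= big_mkcond /=.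
apply: eq_big_seq => a Ea.
rewrite [RHS](exchange_big_dep predT) //=.
transitivity (\sum_(b <- E (n - p)%N | le (c p) a && le (d p) b) h a b).
  by case: (le (c p) a); rewrite ?big_pred0_eq.
rewrite big_mkcond /=; apply: eq_big_seq => b Eb.
rewrite (eq_bigl (fun y => le x y && (y == bsl a b))) => [|y]; last by rewrite (eq_sym y).
by rewrite sum_pick // (bslE p) // (leE p).
Qed.

(** The degree [p] is determined by [a], so each pair of [D] is met exactly once. *)
Lemma sum_graded_pairs n (D : seq (I * I)) : uniq D ->
  (forall ab, ab \in D -> [/\ (sz ab.1 <= n)%N, ab.1 \in E (sz ab.1) &
     ab.2 \in E (n - sz ab.1)%N]) ->
  \sum_(p < n.+1) \sum_(a <- E p) \sum_(b <- E (n - p)%N | (a, b) \in D) h a b =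
  \sum_(ab <- D) h ab.1 ab.2.
Proof.
move=> uD hD.
transitivity (\sum_(p < n.+1) \sum_(a <- E p) \sum_(b <- E (n - p)%N)
    \sum_(ab <- D | ab == (a, b)) h ab.1 ab.2).
  apply: eq_bigr => p _; apply: eq_bigr => a _; rewrite big_mkcond /=.
  by apply: eq_bigr => b _; rewrite (sum_pick predT) // andbT.
transitivity (\sum_(ab <- D) \sum_(p < n.+1) \sum_(a <- E p) \sum_(b <- E (n - p)%N)
    if ab == (a, b) then h ab.1 ab.2 else 0).
  rewrite [RHS]exchange_big; apply: eq_bigr => p _.
  rewrite [RHS]exchange_big; apply: eq_bigr => a _.
  by rewrite [RHS]exchange_big; apply: eq_bigr => b _; rewrite big_mkcond.
apply: eq_big_seq => -[a b] /hD /= [le_an Ea Eb].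
rewrite (bigD1 (Ordinal (le_an : sz a < n.+1)%N)) //= [X in _ + X]big1 ?addr0; last first.
  move=> p ne_p; rewrite big_seq big1 // => a' Ea'; rewrite big1 // => b' _.
  case: eqP => // -[ea _]; case/eqP: ne_p; apply: val_inj => /=.
  by rewrite ea (E_size Ea').
rewrite (bigD1_seq a) //= [X in _ + X]big1 ?addr0; last first.
  by move=> a' ne; rewrite big1 // => b' _; rewrite xpair_eqE eq_sym (negbTE ne).
rewrite (bigD1_seq b) //= eqxx big1 ?addr0 // => b' ne.
by rewrite xpair_eqE [b == b']eq_sym (negbTE ne) andbF.
Qed.

End GradedPairs.

(** * Coproducts, counits and splittings *)

Lemma DeltaS_FS s : is_perm s -> DeltaS (FS s) =
  \sum_(p < (size s).+1) tens (FS (st (take p s))) (FS (st (drop p s))).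
Proof.
move=> ps; rewrite /DeltaS fglift1 val_mkperm //.
by apply: eq_bigr => p _; rewrite tens11.
Qed.

Lemma DeltaY_FY t : DeltaY (FY t) =
  \sum_(p < (tsize t).+1) tens (FY (tsplit p t).1) (FY (tsplit p t).2).
Proof.
rewrite /DeltaY fglift1 splitsE big_map -/(index_iota 0 (tsize t).+1) big_mkord.
by apply: eq_bigr => p _; rewrite tens11 -surjective_pairing.
Qed.

Lemma DeltaS_MS s (D : seq (seq nat * seq nat)) : is_perm s -> uniq D ->
  (forall u v, ((u, v) \in D) = [&& is_perm u, is_perm v & pbsl u v == s]) ->
  DeltaS (MS s) = \sum_(uv <- D) tens (MS uv.1) (MS uv.2).
Proof.
move=> ps uD memD; set n := size s.
have hs : s \in permsn n by rewrite mem_permsn ps eqxx.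
(* [k] must be defined on all permutations of degree [n]: it sums over all factorisations of [y],
   and [D] enters only once [y] is [s]. *)
rewrite (MS_linear (n := n) (f := DeltaS) (k := fun y => \sum_(p < n.+1)
  \sum_(u <- permsn p) \sum_(v <- permsn (n - p)%N | pbsl u v == y) tens (MS u) (MS v))) //.
  rewrite -(@sum_graded_pairs _ permsn size _ (fun u v => tens (MS u) (MS v))
    permsn_uniq _ n) //.
  - apply: eq_bigr => p _; apply: eq_big_seq => u; rewrite mem_permsn => /andP[pu _].
    rewrite big_seq_cond [RHS]big_seq_cond; apply: eq_bigl => v.
    rewrite memD pu mem_permsn; case: (is_perm v) => //=.
  - by move=> p x; rewrite mem_permsn => /andP[_ /eqP].
  move=> [u v]; rewrite memD !mem_permsn /= => /and3P[pu pv /eqP e].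
  have en : n = (size u + size v)%N by rewrite /n -e size_pbsl.
  by rewrite pu pv en addKn !eqxx leq_addr.
move=> x; rewrite mem_permsn => /andP[px /eqP sx].
rewrite [LHS](DeltaS_FS px) sx.
rewrite -(sum_splittings (fun u v => tens (MS u) (MS v)) permsn_uniq
  (c := fun p => st (take p x))
  (d := fun p => st (drop p x))) //.
- apply: eq_bigr => -[p /=]; rewrite ltnS => le_pn _; have ux := is_perm_uniq px.
  rewrite (@MS_expansion p) ?(@MS_expansion (n - p)%N (st (drop p x))) ?tens_sum //.
    by rewrite mem_permsn st_is_perm ?drop_uniq // size_st size_drop sx eqxx.
  by rewrite mem_permsn st_is_perm ?take_uniq // size_st size_takel ?sx ?eqxx.
- move=> p u v le_pn; rewrite !mem_permsn => /andP[pu /eqP su] /andP[pv /eqP sv].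
  by rewrite is_perm_pbsl // size_pbsl su sv subnKC ?eqxx.
move=> p u v le_pn; rewrite !mem_permsn => /andP[pu /eqP su] /andP[pv /eqP sv].
by rewrite pbsl_split_le // ?su // sv sx subnKC.
Qed.

Lemma DeltaY_MY t : DeltaY (MY t) = \sum_(ab <- decs t) tens (MY ab.1) (MY ab.2).
Proof.
set n := tsize t; have ht : t \in treesn n by rewrite treesn_mem.
rewrite (MY_linear (n := n) (f := DeltaY) (k := fun y => \sum_(p < n.+1)
  \sum_(a <- treesn p) \sum_(b <- treesn (n - p)%N | tbsl a b == y) tens (MY a) (MY b))) //.
  rewrite -(@sum_graded_pairs _ treesn tsize _ (fun a b => tens (MY a) (MY b))
    treesn_uniq _ n) ?decs_uniq //.
  - apply: eq_bigr => p _; apply: eq_bigr => a _; apply: eq_bigl => b.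
    by rewrite mem_decs.
  - by move=> p x; rewrite treesn_mem => /eqP.
  move=> [a b]; rewrite mem_decs !treesn_mem /= => /eqP e.
  have en : n = (tsize a + tsize b)%N by rewrite /n -e tsize_tbsl.
  by rewrite en addKn !eqxx leq_addr.
move=> x; rewrite treesn_mem => /eqP sx.
rewrite [LHS]DeltaY_FY sx.
rewrite -(sum_splittings (fun a b => tens (MY a) (MY b)) treesn_uniq
  (c := fun p => (tsplit p x).1)
  (d := fun p => (tsplit p x).2)) //.
- apply: eq_bigr => -[p /=]; rewrite ltnS -sx => le_pn _.
  rewrite (@MY_expansion p) ?(@MY_expansion (tsize x - p)%N (tsplit p x).2) ?tens_sum //.
    by rewrite treesn_mem tsize_tsplit2.
  by rewrite treesn_mem tsize_tsplit1.
- move=> p a b le_pn; rewrite !treesn_mem => /eqP sa /eqP sb.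
  by rewrite tsize_tbsl sa sb subnKC.
move=> p a b le_pn; rewrite !treesn_mem => /eqP sa /eqP sb.
by apply: tbsl_tsplit_le => //; rewrite sa sb sx subnKC.
Qed.

Lemma DeltaS_MS_gamma t :
  DeltaS (MS (gamma t)) = \sum_(ab <- decs t) tens (MS (gamma ab.1)) (MS (gamma ab.2)).
Proof.
rewrite (DeltaS_MS (D := [seq (gamma ab.1, gamma ab.2) | ab <- decs t])).
- by rewrite big_map.
- exact: is_perm_gamma.
- by rewrite map_inj_uniq ?decs_uniq // => -[a b] [c d] /= [/gamma_inj -> /gamma_inj ->].
move=> u v; apply/mapP/and3P => [[[a b] hab [-> ->]]|[pu pv /eqP e]].
  rewrite !is_perm_gamma; split=> //; rewrite -gamma_tbsl.
  by move: hab; rewrite mem_decs => /eqP ->.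
by have [ab hab euv] := pbsl_gamma pu pv e; exists ab.
Qed.

Lemma epsY_MY t : epsY (MY t) = (t == Leaf)%:R.
Proof.
have ht : t \in treesn (tsize t) by rewrite treesn_mem.
apply: (MY_linear (n := tsize t) (f := epsY) (k := fun t => (t == Leaf)%:R : rat^o)) => //.
move=> s /=; rewrite treesn_mem /epsY fglift1 => /eqP <-.
case: s => [|l r] /=; first by rewrite /treesn /= big_cons big_nil addr0.
rewrite big_seq_cond big1 // => -[|l' r'] //.
by rewrite treesn_mem.
Qed.

Lemma epsS_MS s : is_perm s -> epsS (MS s) = (size s == 0%N)%:R.
Proof.
move=> ps; have hs : s \in permsn (size s) by rewrite mem_permsn ps eqxx.
apply: (MS_linear (n := size s) (f := epsS) (k := fun t => (size t == 0%N)%:R : rat^o)) => //.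
move=> u /=; rewrite mem_permsn /epsS fglift1 => /andP[pu /eqP <-]; rewrite val_mkperm //.
case: u {pu} => [|x u]; first by rewrite /permsn /= big_cons big_nil addr0.
rewrite big_seq_cond big1 // => -[|y v] //.
by rewrite mem_permsn andbF.
Qed.

Lemma LambdaM_MS_gamma t : LambdaM (MS (gamma t)) = MY t.
Proof.
set n := tsize t; have ht : t \in treesn n by rewrite treesn_mem.
have hg : gamma t \in permsn n by rewrite mem_permsn is_perm_gamma size_gamma eqxx.
(* As [gamma] is injective, this [k] has the single term [MY u] at [gamma u] and vanishes outside
   the image of [gamma]. *)
rewrite (MS_linear (n := n) (f := LambdaM)
  (k := fun y => \sum_(u <- treesn n | gamma u == y) MY u)) //.
  rewrite (eq_bigl (fun u => predT u && (u == t))) ?sum_pick ?treesn_uniq // ?ht //.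
  by move=> u /=; rewrite (inj_eq gamma_inj).
move=> s /=; rewrite mem_permsn => /andP[ps /eqP ss]; rewrite /LambdaM fglift1 val_mkperm //.
rewrite (@MY_expansion n) ?treesn_mem ?tsize_lambda ?is_perm_uniq ?ss //.
rewrite (exchange_big_dep predT) //= big_mkcond /=; apply: eq_big_seq => u.
rewrite treesn_mem => /eqP su.
rewrite (eq_bigl (fun y => weak_le s y && (y == gamma u))) => [|y]; last by rewrite (eq_sym y).
rewrite sum_pick ?permsn_uniq // mem_permsn is_perm_gamma size_gamma su eqxx /=.
by rewrite lambda_gamma_galois // ss su.
Qed.

Lemma LM_MY_Cmap c : is_comp c -> LM (MY (Cmap c)) = MQ c.
Proof.
move=> hc; set n := sumn c.
have ht : Cmap c \in treesn n by rewrite treesn_mem tsize_Cmap.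
(* Here [k] vanishes outside the trees [C(T)]; at such a tree one term remains, because [Lset]
   recovers [T]. *)
rewrite (MY_linear (n := n) (f := LM) (k := fun y =>
  \sum_(T <- subseqs (iota 1 n.-1) | Cmap (comp_of_set n T) == y) MQ (comp_of_set n T))) //.
  have [T0 hT0 <-] := comp_of_set_surj hc; rewrite -/n in hT0 *.
  rewrite big_seq_cond (eq_bigl (fun T => predT T && (T == T0))).
    by rewrite sum_pick ?hT0 // subseqs_uniq ?iota_uniq.
  move=> T /=; apply/andP/eqP => [[hT /eqP e]|->]; last by rewrite hT0 eqxx.
  by rewrite -(Lset_comp_of_set hT) e Lset_comp_of_set.
move=> t /=; rewrite treesn_mem => /eqP st; rewrite /LM fglift1 /FQ st.
rewrite [RHS](exchange_big_dep predT) //= big_mkcond /=; apply: eq_big_seq => T hT.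
rewrite (eq_bigl (fun y => tam_le t y && (y == Cmap (comp_of_set n T)))) => [|y]; last first.
  by rewrite (eq_sym y).
rewrite sum_pick ?treesn_uniq // treesn_mem tsize_Cmap sumn_comp_of_set // eqxx /=.
by rewrite tam_le_Cmap ?sumn_comp_of_set // Lset_comp_of_set.
Qed.

(** A linear map has to be given on the basis [FY]; expanding [FY t] in the [MY] forces the
    formula. *)
Lemma Gamma_exists :
  exists G : {linear YSym -> SSym}, forall t : tree, G (MY t) = MS (gamma t).
Proof.
exists (fglift (fun t => \sum_(u <- treesn (tsize t) | tam_le t u) MS (gamma u))) => t.
apply: (MY_linear (n := tsize t) (k := MS \o gamma)); last by rewrite treesn_mem.
by move=> s; rewrite treesn_mem => /eqP <-; rewrite /= fglift1.
Qed.

Theorem theorem7p1 :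
  (* existence of the linear map Gamma with Gamma(M_t) = M_{gamma(t)} *)
  (exists G : {linear YSym -> SSym}, forall t : tree, G (MY t) = MS (gamma t)) /\
  (* and for the (unique) such linear map Gamma: *)
  forall G : {linear YSym -> SSym},
    (forall t : tree, G (MY t) = MS (gamma t)) ->
    [/\ (* injectivity *)
        [/\ injective CM, injective G & injective ZM],
        (* morphisms of coalgebras (coproduct and counit) *)
        [/\ (forall v : QSym, DeltaY (CM v) = tmap CM CM (DeltaQ v) /\ epsY (CM v) = epsQ v),
            (forall v : YSym, DeltaS (G v) = tmap G G (DeltaY v) /\ epsS (G v) = epsY v)
          & (forall v : QSym, DeltaS (ZM v) = tmap ZM ZM (DeltaQ v) /\ epsS (ZM v) = epsQ v)],
        (* Gamma o C = Z *)
        (forall v : QSym, G (CM v) = ZM v)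
      & (* splittings *)
        [/\ forall v : QSym, LM (CM v) = v,
            forall v : YSym, LambdaM (G v) = v
          & forall v : QSym, DM (ZM v) = v]].
Proof.
split=> [|G GM]; first exact: Gamma_exists.
have CM1 c : CM << c >> = MY (Cmap (val c)) by apply: fglift1.
have ZM1 c : ZM << c >> = MS (Zmap (val c)) by apply: fglift1.
have GC v : G (CM v) = ZM v.
  apply: (freeg_linear_ext (g := G \o CM)) => c /=.
  by rewrite CM1 ZM1 GM gamma_Cmap.
have LC v : LM (CM v) = v.
  apply: (freeg_linear_ext (g := LM \o CM) (h := idfun)) => c /=.
  by rewrite CM1 LM_MY_Cmap ?(valP c) // /MQ mkcompK.
have LG v : LambdaM (G v) = v.
  apply: (YSym_linear_ext (f := LambdaM \o G) (g := idfun)) => t /=.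
  by rewrite GM LambdaM_MS_gamma.
(* Descents are the left leaves of [lambda], so [D] factors through trees and the splitting by [Z]
   follows from the other two. *)
have DE v : DM v = LM (LambdaM v).
  apply: (freeg_linear_ext (h := LM \o LambdaM)) => x /=.
  rewrite /DM /LambdaM /LM !fglift1 Lset_lambda ?(valP x) //.
  by rewrite tsize_lambda // is_perm_uniq // (valP x).
have DZ v : DM (ZM v) = v by rewrite -GC DE LG LC.
have CD v : DeltaY (CM v) = tmap CM CM (DeltaQ v).
  apply: (freeg_linear_ext (g := DeltaY \o CM) (h := tmap CM CM \o DeltaQ)) => c /=.
  rewrite CM1 DeltaY_MY decs_Cmap ?(valP c) // big_map /DeltaQ fglift1 linear_sum.
  rewrite -/(index_iota 0 (size (val c)).+1) big_mkord; apply: eq_bigr => i _.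
  have := valP c; rewrite -[X in is_comp X](cat_take_drop i) /is_comp all_cat => /andP[h1 h2].
  by rewrite [RHS]tmap1 !CM1 !val_mkcomp.
have CE v : epsY (CM v) = epsQ v.
  apply: (freeg_linear_ext (g := epsY \o CM) (h := epsQ)) => c /=.
  rewrite CM1 epsY_MY /epsQ fglift1; congr ((nat_of_bool _)%:R).
  (* Parts are positive, so the tree of a nonempty composition has at least one node. *)
  case: c => -[|a c] //= hc; apply/negbTE/eqP => /(congr1 tsize).
  by rewrite tsize_Cmap /=; move: hc => /=; lia.
have GD v : DeltaS (G v) = tmap G G (DeltaY v).
  apply: (YSym_linear_ext (f := DeltaS \o G) (g := tmap G G \o DeltaY)) => t /=.
  rewrite GM DeltaS_MS_gamma DeltaY_MY linear_sum; apply: eq_bigr => ab _.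
  by rewrite -!GM [RHS]tmap_tens.
have GE v : epsS (G v) = epsY v.
  apply: (YSym_linear_ext (f := epsS \o G) (g := epsY)) => t /=.
  by rewrite GM epsY_MY epsS_MS ?is_perm_gamma // size_gamma; case: t.
split=> //; split=> //.
- exact: can_inj LC.
- exact: can_inj LG.
- exact: can_inj DZ.
(* The coalgebra property of [Z] comes from those of [Gamma] and [C]; what remains is the
   functoriality of [tmap]. *)
move=> v; rewrite -GC GE CE GD CD; split=> //.
apply: (freeg_linear_ext (g := tmap G G \o tmap CM CM) (h := tmap ZM ZM)) => c /=.
by rewrite !tmap1 tmap_tens !GC.
Qed.
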